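(* Fix $\gamma>0$. Let $(V_M)_{M\ge 1}$ be a sequence of finite-dimensional Galerkin spaces with $V_M\subset L^2_0(\mu)$, and let $\Pi_M$ be the orthogonal projector of $L^2(\mu)$ onto $V_M$. Assume that $$\big\|(A+A^* )(1-\Pi_M)\mathcal L\,\Pi_M\big\|\xrightarrow[M\to\infty]{}0 .$$ Then there exist $C\ge 1$ (independent of $M$ and $\gamma$) and $M_0\in\mathbb N$ such that, for any $M\ge M_0$, there is $\lambda_{\gamma,M}>0$ for which $$\forall \varphi\in V_M,\ \forall t\ge 0,\qquad \big\|\mathrm e^{t\,\Pi_M\mathcal L\Pi_M}\varphi\big\|\le C\,\mathrm e^{-\lambda_{\gamma,M}t}\,\|\varphi\| .$$ Moreover, $\lambda_{\gamma,M}\to\lambda_\gamma$ as $M\to\infty$. If in addition $\mathcal L_{\mathrm{FD}}$ stabilizes $V_M$ (in the sense that $\Pi_M\mathcal L_{\mathrm{FD}}=\mathcal L_{\mathrm{FD}}\Pi_M$), then there exist $M_*\ge 1$ (independent of $\gamma$) and real numbers $\overline\lambda_M$ (independent of $\gamma$) with $\overline\lambda_M\to\overline\lambda$ as $M\to\infty$ such that, for any $M\ge M_*$, the following uniform bound holds on the decay rates $\lambda_{\gamma,M}$ for which $\|\mathrm e^{t\,\Pi_M\mathcal L\Pi_M}\varphi\|\le C\,\mathrm e^{-\lambda_{\gamma,M}t}\,\|\varphi\|$ for all $\varphi\in V_M$ and $t\ge 0$: $$\forall\gamma>0,\qquad \lambda_{\gamma,M}\ge\overline\lambda_M\min(\g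amma,\gamma^{-1}).$$
   Context: Setting. $D\ge 1$ is an integer; the position space $\mathcal D$ is either a torus $(a\mathbb T)^D$, $\mathbb T=\mathbb R/\mathbb Z$, $a>0$, or $\mathbb R^D$; $\beta,m,\gamma>0$; $V:\mathcal D\to\mathbb R$ is smooth with $\mathrm e^{-\beta V}$ integrable. Probability measures: $\mu(dq\,dp)=Z_\mu^{-1}\mathrm e^{-\beta(V(q)+|p|^2/(2m))}dq\,dp$ on $\mathcal D\times\mathbb R^D$, with marginals $\nu(dq)=Z_\nu^{-1}\mathrm e^{-\beta V(q)}dq$ and $\kappa(dp)=(\beta/(2\pi m))^{D/2}\mathrm e^{-\beta|p|^2/(2m)}dp$. $\langle\cdot,\cdot\rangle$ and $\|\cdot\|$ are the scalar product and norm of $L^2(\mu)$, also $\|\cdot\|$ denotes the operator norm on $L^2(\mu)$, and $^*$ is the adjoint on $L^2(\mu)$. $L_0^2(\mu)=\{\varphi\in L^2(\mu):\int\varphi\,d\mu=0\}$, and $\Pi_0\varphi=\varphi-\int\varphi\,d\mu$. Standing assumption on $V$: there is $C_\nu>0$ with $\|\varphi-\int\varphi\,d\nu\|_{L^2(\nu)}^2\le C_\nu^{-1}\|\nabla_q\varphi\|^2_{L^2(\nu)}$ for all $\varphi\in H^1(\nu)$, and there are $c_1>0$, $c_2\in[0,1)$, $c_3>0$ with $\Delta V\le c_1+\frac{c_2}{2}|\nabla V|^2$ and $|\nabla^2V|\le c_3(1+|\nabla V|)$. Operators: $\mathcal L=\mathcal L_{\mathrm{ham}}+\gamma\mathcal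 L_{\mathrm{FD}}$ (generator of the Langevin dynamics, a closed operator on $L^2(\mu)$), with $\mathcal L_{\mathrm{ham}}=\frac{p}{m}\cdot\nabla_q-\nabla V\cdot\nabla_p$ and $\mathcal L_{\mathrm{FD}}=-\frac pm\cdot\nabla_p+\frac1\beta\Delta_p$. $(\Pi_p\varphi)(q)=\int_{\mathbb R^D}\varphi(q,p)\,\kappa(dp)$. The bounded operator $A$ is $A=\big(1+(\mathcal L_{\mathrm{ham}}\Pi_p)^*(\mathcal L_{\mathrm{ham}}\Pi_p)\big)^{-1}(\mathcal L_{\mathrm{ham}}\Pi_p)^*$. The elements of $V_M$ are assumed regular enough (in the domains of $\mathcal L$, $\mathcal L_{\mathrm{ham}}$, $\mathcal L_{\mathrm{FD}}$) for $\mathcal L\Pi_M$, $\mathcal L_{\mathrm{ham}}\Pi_M$, $\mathcal L_{\mathrm{FD}}\Pi_M$ to be defined. Constants (from known hypocoercivity results). There exist $\overline\varepsilon\in(0,1)$, $\overline\lambda>0$ and, for each $\gamma>0$, $\widetilde\lambda_\gamma>0$ such that, with $\varepsilon=\overline\varepsilon\min(\gamma,\gamma^{-1})$, for all $\varphi\in\Pi_0C_c^\infty(\mathcal D\times\mathbb R^D)$, $$\langle-\mathcal L\varphi,\varphi\rangle+\varepsilon\langle A\mathcal L\varphi,\varphi\rangle+\varepsilon\langle A\varphi,\mathcal L\varphi\rangle\ \ge\ \widetilde\lambda_\gamma\|\varphi\|^2 .$$ These are fixed, and $\lambda_\gamma:=\widetilde\lambda_\gamma/(1+\varepsilon)$,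 with $\lambda_\gamma\ge\overline\lambda\min(\gamma,\gamma^{-1})$. The rate $\lambda_\gamma$ is the one for which $\|\mathrm e^{t\mathcal L}\varphi\|\le C\mathrm e^{-\lambda_\gamma t}\|\varphi\|$ for all $\varphi\in L_0^2(\mu)$, $t\ge0$, with $C$ independent of $\gamma$. *)

(* Defs.v *)
From HB Require Import structures.
From mathcomp Require Import all_boot all_order all_algebra.
From mathcomp Require Import all_classical all_reals all_analysis measurable_realfun.
From mathcomp Require Import lra.
Set Implicit Arguments.
Unset Strict Implicit.
Unset Printing Implicit Defensive.
Import Order.TTheory GRing.Theory Num.Theory.
Import numFieldNormedType.Exports.
Local Open Scope classical_set_scope.
Local Open Scope ring_scope.

Fact rV_display : measure_display. Proof. exact: default_measure_display. Qed.

Section measurable_rV.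
Context (R : realType) (n : nat).

Definition rV_coord (i : 'I_n) (x : 'rV[R]_n) : R := x ord0 i.

Let rV_set0 : g_sigma_preimage rV_coord set0.
Proof. exact: sigma_algebra0. Qed.

Let rV_setC A : g_sigma_preimage rV_coord A -> g_sigma_preimage rV_coord (~` A).
Proof. exact: sigma_algebraC. Qed.

Let rV_bigcup (F : (set 'rV[R]_n)^nat) :
  (forall i, g_sigma_preimage rV_coord (F i)) ->
  g_sigma_preimage rV_coord (\bigcup_i (F i)).
Proof. exact: sigma_algebra_bigcup. Qed.

HB.instance Definition _ := @isMeasurable.Build rV_display 'rV[R]_n
  (g_sigma_preimage rV_coord) rV_set0 rV_setC rV_bigcup.

Lemma measurable_rV_coord (i : 'I_n) :
  measurable_fun [set: 'rV[R]_n] (rV_coord i).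
Proof.
move=> _ Y mY; rewrite setTI; apply: sub_sigma_algebra => /=.
rewrite -bigcup_seq/=; exists i => /=; first by rewrite mem_index_enum.
by exists Y => //; rewrite setTI.
Qed.

Lemma measurable_fun_rVP d (T : measurableType d) (f : T -> 'rV[R]_n) :
  (forall i, measurable_fun setT (rV_coord i \o f)) -> measurable_fun setT f.
Proof.
move=> mf _ A mA; rewrite setTI.
have : g_sigma_preimage (fun i => rV_coord i \o f) (f @^-1` A).
  by rewrite g_sigma_preimage_comp; exists A => //; rewrite setTI.
apply: smallest_sub; first exact: sigma_algebra_measurable.
rewrite -bigcup_seq; apply: bigcup_sub => i _ B [C mC <-].
exact: mf.
Qed.

Lemma measurable_rV_ball (x : 'rV[R]_n) (e : R) : 0 < e -> measurable (ball x e).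
Proof.
move=> e0.
rewrite [X in measurable X](_ : _ =
  \bigcap_(i in [set` index_enum 'I_n]) (rV_coord i @^-1` ball (x ord0 i) e)).
  apply: fin_bigcap_measurable; first exact: finite_finset.
  move=> i _; rewrite -[X in measurable X]setTI.
  by apply: measurable_rV_coord => //; exact: measurable_ball.
apply/seteqP; split => [y [_ xy] i _ /=|y xy]; first exact: xy.
split=> // i j; rewrite ord1.
by apply: (xy j) => /=; rewrite mem_index_enum.
Qed.

Lemma measurable_rV_open (U : set 'rV[R]_n) : open U -> measurable U.
Proof.
move=> oU.
pose q (c : 'rV[rat]_n) : 'rV[R]_n := \row_i ratr (c ord0 i).
pose B (cm : 'rV[rat]_n * nat) := ball (q cm.1) (cm.2.+1%:R^-1 : R).
pose F cm := if `[< B cm `<=` U >] then B cm else set0.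
rewrite [X in measurable X](_ : _ = \bigcup_cm F cm).
  apply: countable_bigcupT_measurable => // cm; rewrite /F.
  by case: ifP => // _; exact: measurable_rV_ball.
apply/seteqP; split => [x Ux|x [cm _]]; last first.
  by rewrite /F; case: ifPn => // /asboolP; exact.
have /nbhs_ballP[e /= e0 xeU] : nbhs x U by exact: open_nbhs_nbhs.
have [m me] : exists m, m.+1%:R^-1 < e / 2.
  near \oo => m; exists m; near: m.
  by apply: near_infty_natSinv_lt (PosNum _); rewrite divr_gt0.
have m0 : 0 < m.+1%:R^-1 :> R by rewrite invr_gt0.
have xr i : exists r : rat, x ord0 i - m.+1%:R^-1 < ratr r < x ord0 i + m.+1%:R^-1.
  have /rat_in_itvoo[r] : x ord0 i - m.+1%:R^-1 < x ord0 i + m.+1%:R^-1.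
    by rewrite ltrD2l (lt_trans _ m0)// oppr_lt0.
  by rewrite in_itv/=; exists r.
have [c cP] := choice xr.
pose cm : 'rV[rat]_n * nat := (\row_i c i, m).
have xB : ball x (m.+1%:R^-1 : R) (q cm.1).
  split=> // i j; rewrite /ball/= !mxE ord1 /ball_/= ltr_norml.
  by case/andP: (cP j); move: (m.+1%:R^-1) => k; lra.
exists cm => //; rewrite /F ifT; first exact: ball_sym.
apply/asboolP => y By; apply: xeU.
have -> : e = e / 2 + e / 2 by lra.
apply: le_ball (ball_triangle xB By) => /=.
by move: me; move: (m.+1%:R^-1) => k; lra.
Unshelve. all: by end_near. Qed.

Lemma continuous_measurable_rV (f : 'rV[R]_n -> R) :
  continuous f -> measurable_fun setT f.
Proof.
move=> /continuousP cf.
apply: (measurability _ (RGenOpens.measurableE R)) => _ [_ [a [b ->] <-]].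
by rewrite setTI; apply: measurable_rV_open; apply: cf; exact: interval_open.
Qed.

End measurable_rV.

Lemma product_sigma_finite d1 d2 (T1 : measurableType d1) (T2 : measurableType d2)
    (R : realType) (m1 : {sigma_finite_measure set T1 -> \bar R})
    (m2 : {sigma_finite_measure set T2 -> \bar R}) :
  sigma_finite setT (m1 \x m2)%E.
Proof.
have /sigma_finiteP[F [TF ndF Foo]] := sigma_finiteT m1.
have /sigma_finiteP[G [TG ndG Goo]] := sigma_finiteT m2.
exists (fun n => F n `*` G n).
  rewrite -setXTT TF TG predeqE => -[x y]; split.
    move=> [/= [n _ Fnx] [k _ Gky]]; exists (maxn n k) => //; split.
    - by move: x Fnx; exact/subsetPset/ndF/leq_maxl.
    - by move: y Gky; exact/subsetPset/ndG/leq_maxr.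
  by move=> [n _ []/= ? ?]; split; exists n.
move=> k; have [? ?] := Foo k; have [? ?] := Goo k.
split; first exact: measurableX.
by rewrite product_measure1E// lte_mul_pinfty// ge0_fin_numE.
Qed.

Section lebesgue_rV.
Context (R : realType).

Definition rV_cons n (x : R * 'rV[R]_n) : 'rV[R]_n.+1 :=
  \row_i oapp (fun j => x.2 ord0 j) x.1 (unlift ord0 i).

Definition rV_uncons n (x : 'rV[R]_n.+1) : R * 'rV[R]_n :=
  (x ord0 ord0, \row_j x ord0 (lift ord0 j)).

Lemma rV_consK n : cancel (@rV_cons n) (@rV_uncons n).
Proof.
move=> [a v]; rewrite /rV_uncons /rV_cons !mxE unlift_none/=; congr pair.
by apply/rowP => j; rewrite !mxE liftK.
Qed.

Lemma rV_unconsK n : cancel (@rV_uncons n) (@rV_cons n).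
Proof.
by move=> x; apply/rowP => i; rewrite !mxE; case: unliftP => [j|] ->; rewrite /= ?mxE.
Qed.

Lemma measurable_rV_cons n : measurable_fun setT (@rV_cons n).
Proof.
apply: measurable_fun_rVP => i; rewrite /comp/=.
case: (unliftP ord0 i) => [j|] ->; rewrite /rV_coord /rV_cons.
  under eq_fun => x do rewrite mxE liftK/=.
  exact: measurableT_comp (measurable_rV_coord j) measurable_snd.
under eq_fun => x do rewrite mxE unlift_none/=.
exact: measurable_fst.
Qed.

Lemma measurable_rV_uncons n : measurable_fun setT (@rV_uncons n).
Proof.
apply/measurable_fun_pairP; split; first exact: measurable_rV_coord.
apply: measurable_fun_rVP => j; rewrite /comp/=.
rewrite [X in measurable_fun _ X](_ : _ = rV_coord (lift ord0 j)).
  exact: measurable_rV_coord.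
by apply/funext => x; rewrite /rV_coord mxE.
Qed.

Section step.
Context (n : nat) (m : {sigma_finite_measure set 'rV[R]_n -> \bar R}).

Definition lebesgue_rV_step : set 'rV[R]_n.+1 -> \bar R :=
  pushforward (lebesgue_measure \x m)%E (@rV_cons n).

Let mu0 : lebesgue_rV_step set0 = 0%E.
Proof. by rewrite /lebesgue_rV_step /pushforward preimage_set0 measure0. Qed.

Let mu_ge0 A : (0 <= lebesgue_rV_step A)%E.
Proof. by rewrite /lebesgue_rV_step /pushforward; exact: measure_ge0. Qed.

Let mu_sigma : semi_sigma_additive lebesgue_rV_step.
Proof.
move=> F mF tF mUF; rewrite /lebesgue_rV_step /pushforward preimage_bigcup.
have mc B : measurable B -> measurable (@rV_cons n @^-1` B).
  by move=> mB; rewrite -[X in measurable X]setTI; exact: measurable_rV_cons.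
apply: measure_semi_sigma_additive => [i||]; first exact: mc.
- apply/trivIsetP => /= i j _ _ ij; rewrite -preimage_setI.
  by move/trivIsetP : tF => /(_ _ _ _ _ ij) ->//; rewrite preimage_set0.
- by rewrite -preimage_bigcup; exact: mc.
Qed.

HB.instance Definition _ := isMeasure.Build _ _ _ lebesgue_rV_step
  mu0 mu_ge0 mu_sigma.

Let mu_sigma_finite : sigma_finite setT lebesgue_rV_step.
Proof.
have [F FT mF] := product_sigma_finite (@lebesgue_measure R) m.
exists (fun k => @rV_uncons n @^-1` F k).
  by rewrite -preimage_bigcup -FT preimage_setT.
move=> k; have [mFk Fk] := mF k; split.
  by rewrite -[X in measurable X]setTI; exact: measurable_rV_uncons.
rewrite /lebesgue_rV_step /pushforward -comp_preimage.
by rewrite (_ : _ \o _ = id) ?preimage_id//; apply/funext => x /=; rewrite rV_consK.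
Qed.

HB.instance Definition _ := Measure_isSigmaFinite.Build _ _ _ lebesgue_rV_step
  mu_sigma_finite.

End step.

Fixpoint lebesgue_rV n : {sigma_finite_measure set 'rV[R]_n -> \bar R} :=
  if n is n'.+1 then lebesgue_rV_step (lebesgue_rV n')
  else @dirac _ 'rV[R]_0 (0 : 'rV[R]_0) R.

End lebesgue_rV.

Section weighted_measure.
Context d (T : measurableType d) (R : realType) (m : {measure set T -> \bar R}).
Variables (D : set T) (w : T -> R).

Definition weighted_measure (mD : measurable D) (mw : measurable_fun setT w)
    (w0 : forall x, 0 <= w x) (A : set T) : \bar R :=
  (\int[m]_(x in A `&` D) (w x)%:E)%E.

Variables (mD : measurable D) (mw : measurable_fun setT w).
Hypothesis w0 : forall x, 0 <= w x.

Local Notation wm := (weighted_measure mD mw w0).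

Let wm0 : wm set0 = 0%E.
Proof. by rewrite /weighted_measure set0I integral_set0. Qed.

Let wm_ge0 A : (0 <= wm A)%E.
Proof. by apply: integral_ge0 => x _; rewrite lee_fin. Qed.

Let wm_sigma_additive : semi_sigma_additive wm.
Proof.
rewrite (_ : weighted_measure _ _ _ =
    fun A => (\int[m]_(x in A) ((fun x => (w x)%:E) \_ D) x)%E); last first.
  by apply/funext => A; rewrite /weighted_measure integral_mkcondr.
apply: semi_sigma_additive_nng_induced => [|x].
  by apply/(measurable_restrictT _ mD); apply: measurable_funTS; exact/measurable_EFinP.
by rewrite patchE; case: ifP => // _; rewrite lee_fin.
Qed.

HB.instance Definition _ := isMeasure.Build _ _ _ wm wm0 wm_ge0 wm_sigma_additive.

End weighted_measure.

Section smooth.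
Context (R : realType) (E : normedModType R).

Definition iter_derive (s : seq E) (f : E -> R) : E -> R :=
  foldr (fun v g => 'D_v g) f s.

(* C^oo for finite-dimensional E: all iterated directional derivatives exist
   and are continuous. *)
Definition smooth (f : E -> R) := forall s : seq E,
  continuous (iter_derive s f) /\
  forall x v, derivable (iter_derive s f) x v.

End smooth.

Variant position_space (R : realType) := Torus of R | Euclidean.
Arguments Euclidean {R}.

Section position.
Context (R : realType) (D : nat).
Implicit Type X : position_space R.

Definition basis_rV (i : 'I_D) : 'rV[R]_D := delta_mx ord0 i.

Definition sqnorm (x : 'rV[R]_D) : R := \sum_i x ord0 i ^+ 2.

(* Functions on the torus (a T)^D are represented by functions on R^D that are
   a-periodic in each coordinate, and integrals over the torus by integrals over
   the cell [0, a[^D. *)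
Definition cell X : set 'rV[R]_D :=
  if X is Torus a then [set q | forall i, 0 <= q ord0 i < a] else setT.

Definition valid_space X : Prop := if X is Torus a then 0 < a else True.

Definition periodic (T : Type) X (f : 'rV[R]_D -> T) : Prop :=
  if X is Torus a then forall q i, f (q + a *: basis_rV i) = f q else True.

Lemma measurable_cell X : measurable (cell X).
Proof.
case: X => [a|]; last exact: measurableT.
rewrite (_ : cell _ =
  \bigcap_(i in [set` index_enum 'I_D]) (rV_coord i @^-1` [set` `[0, a[])).
  apply: fin_bigcap_measurable; first exact: finite_finset.
  move=> i _; rewrite -[X in measurable X]setTI.
  by apply: measurable_rV_coord => //; exact: measurable_itv.
apply/seteqP; split => q /= hq i; first by move=> _; rewrite /= in_itv/= hq.
by have := hq i (mem_index_enum i); rewrite /= in_itv.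
Qed.

End position.
Arguments basis_rV {R D} i.
Arguments cell {R D} X.

Record langevin (R : realType) := Langevin {
  dim : nat;
  dim_gt0 : (0 < dim)%N;
  space : position_space R;
  space_valid : valid_space space;
  beta : R;
  beta_gt0 : 0 < beta;
  mass : R;
  mass_gt0 : 0 < mass;
  potential : 'rV[R]_dim -> R;
  potential_periodic : periodic space potential;
  potential_smooth : smooth potential;
  potential_integrable : (lebesgue_rV R dim).-integrable (cell space)
    (fun q => (expR (- beta * potential q))%:E)
}.

Arguments potential {R} _ _.

Section gibbs.
Context (R : realType) (S : langevin R).

Notation pos := 'rV[R]_(dim S).
Notation phase := ('rV[R]_(dim S) * 'rV[R]_(dim S))%type.
Notation dq := (lebesgue_rV R (dim S)).
Notation dqdp := (dq \x dq)%E.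

Definition hamiltonian (x : phase) : R :=
  potential S x.1 + sqnorm x.2 / (2 * mass S).

Definition q_cell : set pos := cell (space S).

Definition nu_density (q : pos) : R :=
  (\int[dq]_(q in q_cell) expR (- beta S * potential S q))^-1 *
  expR (- beta S * potential S q).

Definition kappa_density (p : pos) : R :=
  (beta S / (2 * pi * mass S)) `^ ((dim S)%:R / 2) *
  expR (- beta S * (sqnorm p / (2 * mass S))).

Definition mu_density (x : phase) : R :=
  (\int[dqdp]_(x in q_cell `*` setT) expR (- beta S * hamiltonian x))^-1 *
  expR (- beta S * hamiltonian x).

Lemma measurable_q_cell : measurable q_cell.
Proof. exact: measurable_cell. Qed.

Lemma measurable_phase_cell : measurable (q_cell `*` [set: pos]).
Proof. by apply: measurableX => //; exact: measurable_q_cell. Qed.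

Lemma measurable_potential : measurable_fun setT (potential S).
Proof. by apply: continuous_measurable_rV; have [] := @potential_smooth _ S [::]. Qed.

Lemma measurable_sqnorm : measurable_fun setT (@sqnorm R (dim S)).
Proof.
apply: measurable_sum => i; apply: measurable_funX.
exact: (@measurable_rV_coord R (dim S) i).
Qed.

Lemma measurable_nu_density : measurable_fun setT nu_density.
Proof.
apply: measurable_funM => //; apply: measurableT_comp => //.
by apply: measurable_funM => //; exact: measurable_potential.
Qed.

Lemma measurable_kappa_density : measurable_fun setT kappa_density.
Proof.
apply: measurable_funM => //; apply: measurableT_comp => //.
apply: measurable_funM => //; apply: measurable_funM => //.
exact: measurable_sqnorm.
Qed.

Lemma measurable_mu_density : measurable_fun setT mu_density.
Proof.
apply: measurable_funM => //; apply: measurableT_comp => //.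
apply: measurable_funM => //; apply: measurable_funD.
  exact: measurableT_comp measurable_potential measurable_fst.
apply: measurable_funM => //.
exact: measurableT_comp measurable_sqnorm measurable_snd.
Qed.

Lemma nu_density_ge0 q : 0 <= nu_density q.
Proof.
by rewrite mulr_ge0 ?expR_ge0// invr_ge0 fine_ge0// integral_ge0// => x _;
  rewrite lee_fin expR_ge0.
Qed.

Lemma kappa_density_ge0 p : 0 <= kappa_density p.
Proof. by rewrite mulr_ge0 ?expR_ge0// powR_ge0. Qed.

Lemma mu_density_ge0 x : 0 <= mu_density x.
Proof.
by rewrite mulr_ge0 ?expR_ge0// invr_ge0 fine_ge0// integral_ge0// => y _;
  rewrite lee_fin expR_ge0.
Qed.

Definition nu : {measure set pos -> \bar R} :=
  weighted_measure dq measurable_q_cell measurable_nu_density nu_density_ge0.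

Definition kappa : {measure set pos -> \bar R} :=
  weighted_measure dq measurableT measurable_kappa_density kappa_density_ge0.

Definition mu : {measure set phase -> \bar R} :=
  weighted_measure dqdp measurable_phase_cell measurable_mu_density mu_density_ge0.

End gibbs.
Arguments q_cell {R} S.
Arguments nu {R} S.
Arguments kappa {R} S.
Arguments mu {R} S.

Section L2.
Context d (T : measurableType d) (R : realType) (m : {measure set T -> \bar R}).

Local Notation Lfun2 := (LfunType m (lee1n 2)).

Definition null_fun : {pred Lfun2} :=
  [pred f : Lfun2 | `[< (f : T -> R) = cst 0 %[ae m] >]].

Lemma null_fun_zmod_closed : zmod_closed null_fun.
Proof.
split=> [|f g]; rewrite !inE; first exact: aeW.
by move=> f0 g0; apply: filterS2 f0 g0 => x /= fx gx _;
  transitivity (f x - g x) => //; rewrite fx// gx// subrr.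
Qed.

HB.instance Definition _ := GRing.isZmodClosed.Build Lfun2 null_fun
  null_fun_zmod_closed.

Lemma null_funZ a (f : Lfun2) : f \in null_fun -> a *: f \in null_fun.
Proof.
rewrite !inE => f0; apply: filterS f0 => x /= fx _.
by transitivity (a * f x) => //; rewrite fx// mulr0.
Qed.

Definition L2 : Type := Quotient.quot null_fun.
HB.instance Definition _ := GRing.Zmodule.on L2.

Definition pi_L2 : Lfun2 -> L2 := \pi_(Quotient.quot null_fun)%qT.

Definition scaleL2 (a : R) (F : L2) : L2 :=
  pi_L2 (a *: (repr (F : Quotient.quot null_fun) : Lfun2)).

Lemma pi_L2K (F : L2) : pi_L2 (repr (F : Quotient.quot null_fun)) = F.
Proof. exact: reprK. Qed.

Lemma pi_L2D f g : pi_L2 (f + g) = pi_L2 f + pi_L2 g.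
Proof. by rewrite /pi_L2 !piE. Qed.

Lemma pi_L2Z a f : pi_L2 (a *: f) = scaleL2 a (pi_L2 f).
Proof.
apply/eqP; rewrite /pi_L2 -Quotient.idealrBE -scalerBr; apply: null_funZ.
by rewrite Quotient.idealrBE reprK.
Qed.

Let scalerA a b F : scaleL2 a (scaleL2 b F) = scaleL2 (a * b) F.
Proof. by rewrite -[F]pi_L2K -!pi_L2Z scalerA. Qed.

Let scale1 : left_id 1 scaleL2.
Proof. by move=> F; rewrite -[F]pi_L2K -!pi_L2Z scale1r. Qed.

Let scaleDr : right_distributive scaleL2 +%R.
Proof.
by move=> a F G; rewrite -[F]pi_L2K -[G]pi_L2K -!pi_L2Z -!pi_L2D -!pi_L2Z scalerDr.
Qed.

Let scaleDl F : {morph scaleL2^~ F : a b / a + b}.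
Proof. by move=> a b; rewrite -[F]pi_L2K -!pi_L2Z -!pi_L2D scalerDl. Qed.

HB.instance Definition _ := GRing.Zmodule_isLmodule.Build R L2
  scalerA scale1 scaleDr scaleDl.

Definition L2fun (F : L2) : T -> R := (repr (F : Quotient.quot null_fun) : Lfun2).

(* F is the class of f; the membership of f in L^2 is part of the relation. *)
Definition L2_class (F : L2) (f : T -> R) : Prop := L2fun F = f %[ae m].

Definition dot (F G : L2) : R := \int[m]_x (L2fun F x * L2fun G x).

Definition normL2 (F : L2) : R := Num.sqrt (dot F F).

Definition mean (F : L2) : R := \int[m]_x L2fun F x.

End L2.

Record operator (H : Type) := Operator { domain : set H; app :> H -> H }.

Definition graph H (B : operator H) : set (H * H) :=
  [set fg | domain B fg.1 /\ fg.2 = B fg.1].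

Section L2_operators.
Context d (T : measurableType d) (R : realType) (m : {measure set T -> \bar R}).
Local Notation H := (L2 m).

Definition cvgL2 (u : nat -> H) (f : H) : Prop :=
  normL2 (u n - f) @[n --> \oo] --> 0.

Definition closure_graph (G : set (H * H)) : set (H * H) :=
  [set fg | exists u : nat -> H * H, [/\ forall n, G (u n),
    cvgL2 (fst \o u) fg.1 & cvgL2 (snd \o u) fg.2]].

Definition adjoint_graph (G : set (H * H)) : set (H * H) :=
  [set uv | forall fg, G fg -> dot fg.2 uv.1 = dot fg.1 uv.2].

Definition is_adjoint (B Bs : H -> H) : Prop :=
  forall f g, dot (B f) g = dot f (Bs g).

Definition op_norm (B : H -> H) : \bar R :=
  ereal_sup [set (normL2 (B f))%:E | f in [set f | normL2 f <= 1]].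

Definition L20 : set H := [set f | mean f = 0].

Definition finite_dim_subspace (W : set H) : Prop :=
  exists n (e : 'I_n -> H),
    W = [set f | exists c : 'I_n -> R, f = \sum_i c i *: e i].

Definition orth_proj (W : set H) (f : H) : H :=
  xget 0 [set g | W g /\ forall h, W h -> dot (f - g) h = 0].

Definition exp_op (B : H -> H) (t : R) (f : H) : H :=
  xget 0 [set g |
    cvgL2 (fun n => \sum_(0 <= k < n) (t ^+ k / k`!%:R) *: iter k B f) g].

End L2_operators.
Arguments L20 {d T R} m.

Section langevin_operators.
Context (R : realType) (S : langevin R).

Notation pos := 'rV[R]_(dim S).
Notation phase := ('rV[R]_(dim S) * 'rV[R]_(dim S))%type.
Notation H := (L2 (mu S)).

Definition partial (i : 'I_(dim S)) (f : pos -> R) : pos -> R :=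
  'D_(basis_rV i) f.

Definition dq (i : 'I_(dim S)) (f : phase -> R) : phase -> R :=
  'D_((basis_rV i, 0) : phase) f.

Definition dp (i : 'I_(dim S)) (f : phase -> R) : phase -> R :=
  'D_((0, basis_rV i) : phase) f.

Definition ham_expr (f : phase -> R) (x : phase) : R :=
  \sum_i (x.2 ord0 i / mass S * dq i f x
          - partial i (potential S) x.1 * dp i f x).

Definition FD_expr (f : phase -> R) (x : phase) : R :=
  \sum_i (- (x.2 ord0 i / mass S) * dp i f x + (beta S)^-1 * dp i (dp i f) x).

Definition langevin_expr (gamma : R) (f : phase -> R) (x : phase) : R :=
  ham_expr f x + gamma * FD_expr f x.

(* C_c^oo functions on position space and on phase space; on the torus only the
   momentum needs to stay in a bounded set. *)
Definition test_pos (f : pos -> R) : Prop :=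
  [/\ smooth f, periodic (space S) f &
   exists K : R, forall q, (if space S is Torus _ then False else K < `|q|) ->
     f q = 0].

Definition test_phase (f : phase -> R) : Prop :=
  [/\ smooth f, periodic (space S) (fun q p => f (q, p)) &
   exists K : R, forall q p,
     (if space S is Torus _ then False else K < `|q|) \/ K < `|p| ->
     f (q, p) = 0].

Definition test_graph (E : (phase -> R) -> phase -> R) : set (H * H) :=
  [set fg | exists phi, [/\ test_phase phi, L2_class fg.1 phi
                          & L2_class fg.2 (E phi)]].

(* phi is in H^1(nu) with weak gradient g. *)
Definition H1_grad (phi : pos -> R) (g : 'I_(dim S) -> pos -> R) : Prop :=
  [/\ phi \in Lfun (nu S) 2%:E, forall i, g i \in Lfun (nu S) 2%:E &
   forall i chi, test_pos chi ->
     \int[lebesgue_rV R (dim S)]_(q in q_cell S) (phi q * partial i chi q) =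
     - \int[lebesgue_rV R (dim S)]_(q in q_cell S) (g i q * chi q)].

Definition poincare (C : R) : Prop := forall phi g, H1_grad phi g ->
  \int[nu S]_q ((phi q - \int[nu S]_q' phi q') ^+ 2) <=
  C^-1 * \int[nu S]_q (\sum_i g i q ^+ 2).

Definition grad_sq (q : pos) : R := \sum_i partial i (potential S) q ^+ 2.

Definition laplacian (q : pos) : R :=
  \sum_i partial i (partial i (potential S)) q.

Definition hessian_norm (q : pos) : R :=
  Num.sqrt (\sum_i \sum_j partial i (partial j (potential S)) q ^+ 2).

Definition potential_assumption : Prop :=
  (exists2 C, 0 < C & poincare C) /\
  (exists c1 c2 c3 : R, [/\ 0 < c1, 0 <= c2 < 1, 0 < c3 & forall q,
     laplacian q <= c1 + c2 / 2 * grad_sq q /\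
     hessian_norm q <= c3 * (1 + Num.sqrt (grad_sq q))]).

Definition is_Pip (f g : H) : Prop :=
  L2_class g (fun x => \int[kappa S]_p L2fun f (x.1, p)).

Section operator_A.
Variable Lham : operator H.

Definition ham_Pip_graph : set (H * H) :=
  [set fg | exists2 h, is_Pip fg.1 h & graph Lham (h, fg.2)].

(* graph of (1 + T^* T)^{-1} T^* for T = Lham Pi_p: (u, w) belongs to it when
   w + T^* (T w) = T^* u. *)
Definition A_graph : set (H * H) :=
  [set uw | exists v g,
    [/\ adjoint_graph ham_Pip_graph (uw.1, v),
        ham_Pip_graph (uw.2, g) &
        adjoint_graph ham_Pip_graph (g, v - uw.2)]].

End operator_A.

(* The closed operators Lham, LFD and L gamma are the closures of the differential
   operators on C_c^oo, with L gamma = Lham + gamma LFD on the common domain.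
   (1 + T^* T)^{-1} T^* is only defined on the dense domain of T^*: A is the
   everywhere defined operator whose graph is the closure of its graph. *)
Record langevin_operators (Lham LFD : operator H) (L : R -> operator H)
    (A As : H -> H) : Prop := {
  Lham_closure : graph Lham = closure_graph (test_graph ham_expr);
  LFD_closure : graph LFD = closure_graph (test_graph FD_expr);
  L_closure : forall gamma, 0 < gamma ->
    graph (L gamma) = closure_graph (test_graph (langevin_expr gamma));
  L_sum : forall gamma f, 0 < gamma ->
    domain (L gamma) f -> domain Lham f -> domain LFD f ->
    L gamma f = Lham f + gamma *: LFD f;
  A_closure : [set uw | uw.2 = A uw.1] = closure_graph (A_graph Lham);
  A_adjoint : is_adjoint A As
}.

Definition friction_min (gamma : R) : R := Num.min gamma gamma^-1.

(* Pi_0 phi is the smooth function phi - \int phi dmu, to which the differential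
   operator is applied pointwise. *)
Definition coercive (A : H -> H) (gamma eps lam : R) : Prop :=
  forall phi, test_phase phi ->
  let phi0 x := phi x - \int[mu S]_y phi y in
  forall f g : H, L2_class f phi0 -> L2_class g (langevin_expr gamma phi0) ->
  lam * normL2 f ^+ 2 <=
    - dot g f + eps * dot (A g) f + eps * dot (A f) g.

Record hypocoercivity_constants (A : H -> H) (epsbar lambar : R)
    (lamt : R -> R) : Prop := {
  epsbar_itv : 0 < epsbar < 1;
  lambar_gt0 : 0 < lambar;
  lamt_gt0 : forall gamma, 0 < gamma -> 0 < lamt gamma;
  lamt_coercive : forall gamma, 0 < gamma ->
    coercive A gamma (epsbar * friction_min gamma) (lamt gamma);
  lamt_ge : forall gamma, 0 < gamma ->
    lambar * friction_min gamma <=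
    lamt gamma / (1 + epsbar * friction_min gamma)
}.

Definition galerkin_op (B : H -> H) (W : set H) (f : H) : H :=
  orth_proj W (B (orth_proj W f)).

Definition consistency_op (A As : H -> H) (L : H -> H) (W : set H) (f : H) : H :=
  let Lf := L (orth_proj W f) in
  let g := Lf - orth_proj W Lf in
  A g + As g.

Definition decay_rate (L : H -> H) (W : set H) (C lam : R) : Prop :=
  0 < lam /\ forall f, W f -> forall t, 0 <= t ->
    normL2 (exp_op (galerkin_op L W) t f) <= C * expR (- lam * t) * normL2 f.

Definition stabilizes (B : operator H) (W : set H) : Prop :=
  forall f, domain B f ->
    domain B (orth_proj W f) /\ orth_proj W (B f) = B (orth_proj W f).

End langevin_operators.
Arguments potential_assumption {R} S.

(* Main.v *)
(** The functional [Q f f = |f|^2 / 2 - eps <A f, f>] is equivalent to the squared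
    norm, with constants [(1 - eps) / 2] and [(1 + eps) / 2], because [|A| <= 1/2].
    The coercivity estimate extends from test functions to the mean-zero part of
    the domain of [L], hence to the Galerkin space.  Along the flow of
    [Pi_M L Pi_M] one has [Pi_M L f = L f - (1 - Pi_M) L f], so the derivative of
    [Q] is minus the coercive form plus [eps <(A + A^* ) (1 - Pi_M) L f, f>]; hence
    [Q] decays at the rate [2 (lamt - eps delta_M) / (1 + eps)], where [delta_M] is
    the norm of the consistency operator.  When the fluctuation-dissipation part
    stabilizes the Galerkin space it drops out of [(1 - Pi_M) L Pi_M], and
    [delta_M] no longer depends on the friction. *)
Require Import Defs.
From mathcomp Require Import all_boot all_order all_algebra.
From mathcomp Require Import all_classical all_reals all_analysis.
From mathcomp Require Import measurable_realfun ring lra.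
Import Order.TTheory GRing.Theory Num.Theory.
Import numFieldNormedType.Exports.
Local Open Scope classical_set_scope.
Local Open Scope ring_scope.
Set Implicit Arguments.
Unset Strict Implicit.
Unset Printing Implicit Defensive.

(** * The Hilbert space [L2] *)

Section L2_inner_product.
Context d (T : measurableType d) (R : realType) (m : {measure set T -> \bar R}).
Local Notation H := (L2 m).
Implicit Types (F G K : H) (f g : T -> R).

Lemma L2fun_Lfun F : L2fun F \in Lfun m 2%:E.
Proof. exact: LfunP. Qed.

Lemma measurable_L2fun F : measurable_fun setT (L2fun F).
Proof. by have /sub_Lfun_mfun := L2fun_Lfun F; rewrite inE. Qed.

Lemma integrable_L2fun_mul F G :
  m.-integrable setT (EFin \o (fun x => L2fun F x * L2fun G x)).
Proof.
exact/Lfun1_integrable/(Lfun2_mul_Lfun1 (L2fun_Lfun F) (L2fun_Lfun G)).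
Qed.

Lemma pi_L2_eq (f g : LfunType m (lee1n 2)) :
  pi_L2 f = pi_L2 g <-> (f : T -> R) = g %[ae m].
Proof.
rewrite (_ : (pi_L2 f = pi_L2 g) <-> (f - g) \in @Defs.null_fun _ _ _ m); last first.
  by rewrite Quotient.idealrBE; split=> /eqP.
rewrite inE; split=> [/= h|h].
  apply: filterS h => x /= {}h _; apply/eqP; rewrite -subr_eq0; apply/eqP.
  exact: h.
apply: filterS h => x /= h _.
by transitivity (f x - g x) => //; rewrite h// subrr.
Qed.

Lemma L2fun_pi (f : LfunType m (lee1n 2)) : L2_class (pi_L2 f) f.
Proof. by apply/pi_L2_eq; rewrite pi_L2K. Qed.

(** The representative held by a class is an arbitrary choice, so pointwise identities pass through
    [pi_L2] and survive only almost everywhere. *)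
Lemma L2_class_lin F G f g a : L2_class F f -> L2_class G g ->
  L2_class (a *: F + G) (fun x => a * f x + g x).
Proof.
move=> Ff Gg.
have : L2_class (pi_L2 (a *: (repr (F : Quotient.quot (@Defs.null_fun _ _ _ m)))
    + repr (G : Quotient.quot (@Defs.null_fun _ _ _ m))))
    (fun x => a * L2fun F x + L2fun G x).
  exact: L2fun_pi.
rewrite pi_L2D pi_L2Z !pi_L2K => h.
apply: filterS3 h Ff Gg => x h Ff Gg _; transitivity (a * L2fun F x + L2fun G x).
  exact: h.
by rewrite Ff// Gg.
Qed.

Lemma L2fun_lin a F G :
  L2_class (a *: F + G) (fun x => a * L2fun F x + L2fun G x).
Proof. by apply: L2_class_lin; exact: aeW. Qed.

Lemma dotC F G : dot F G = dot G F.
Proof. by rewrite /dot; under eq_fun do rewrite mulrC. Qed.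

Lemma dot_lin a F G K : dot (a *: F + G) K = a * dot F K + dot G K.
Proof.
rewrite /dot -RintegralZl//; last exact: integrable_L2fun_mul.
rewrite -RintegralD//; last 2 first.
- rewrite (_ : _ \o _ =
      (fun x => a%:E * (EFin \o (fun x => (L2fun F x * L2fun K x)%R)) x)%E).
    by apply: integrableZl => //; exact: integrable_L2fun_mul.
  by apply/funext => x /=; rewrite EFinM.
- exact: integrable_L2fun_mul.
(* The chosen representative of [a *: F + G] agrees with the combination of representatives only
   almost everywhere, which is enough under the integral. *)
rewrite /Rintegral; congr fine; apply: ae_eq_integral => //.
- by have /measurable_int := integrable_L2fun_mul (a *: F + G) K.
- apply/measurable_EFinP; apply: measurable_funD;
    repeat apply: measurable_funM => //; exact: measurable_L2fun.
apply: filterS (L2fun_lin a F G) => x h _ /=.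
by rewrite h//; congr EFin; ring.
Qed.

Lemma dot_ge0 F : 0 <= dot F F.
Proof. by apply: Rintegral_ge0 => x _; rewrite -expr2 sqr_ge0. Qed.

Lemma dot_eq0 F : dot F F = 0 -> F = 0.
Proof.
move=> F0.
have : ae_eq m setT (EFin \o (fun x => L2fun F x * L2fun F x)) (cst 0)%E.
  apply/ae_eq_integral_abs => //.
    by have /measurable_int := integrable_L2fun_mul F F.
  (* A square is its own absolute value. Integrability excludes that [fine] has turned an infinite
     integral into 0. *)
  rewrite (_ : (fun x => _) = (EFin \o (fun x => L2fun F x * L2fun F x))).
    rewrite -[LHS]fineK; first by rewrite -[fine _]/(dot F F) F0.
    by apply: integrable_fin_num => //; exact: integrable_L2fun_mul.
  by apply/funext => x /=; rewrite ger0_norm// -expr2 sqr_ge0.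
move=> h; rewrite -[LHS]pi_L2K.
transitivity (pi_L2 (0 : LfunType m (lee1n 2))).
  apply/pi_L2_eq; apply: filterS h => x /= /(_ I) h _.
  case: h => /eqP; rewrite -expr2 sqrf_eq0 => /eqP h.
  by rewrite -[LHS]/(L2fun F x) h.
by apply: (addrI (pi_L2 0)); rewrite -pi_L2D !addr0.
Qed.

End L2_inner_product.

(** * Bilinearity, Cauchy-Schwarz and convergence in the norm of [L2] *)

Section L2_geometry.
Context d (T : measurableType d) (R : realType) (m : {measure set T -> \bar R}).
Local Notation H := (L2 m).
Implicit Types (F G K : H) (u v : nat -> H).

Lemma dotDl F G K : dot (F + G) K = dot F K + dot G K.
Proof. by have := dot_lin 1 F G K; rewrite scale1r mul1r. Qed.

Lemma dot0l K : dot 0 K = 0.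
Proof. by apply: (addrI (dot 0 K)); rewrite -dotDl !addr0. Qed.

Lemma dotZl a F K : dot (a *: F) K = a * dot F K.
Proof. by have := dot_lin a F 0 K; rewrite dot0l !addr0. Qed.

Lemma dotNl F K : dot (- F) K = - dot F K.
Proof. by rewrite -scaleN1r dotZl mulN1r. Qed.

Lemma dotBl F G K : dot (F - G) K = dot F K - dot G K.
Proof. by rewrite dotDl dotNl. Qed.

Lemma dotDr F G K : dot K (F + G) = dot K F + dot K G.
Proof. by rewrite !(dotC K) dotDl. Qed.

Lemma dot0r K : dot K 0 = 0.
Proof. by rewrite dotC dot0l. Qed.

Lemma dotZr a F K : dot K (a *: F) = a * dot K F.
Proof. by rewrite !(dotC K) dotZl. Qed.

Lemma dotBr F G K : dot K (F - G) = dot K F - dot K G.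
Proof. by rewrite !(dotC K) dotBl. Qed.

Lemma dot_suml I (r : seq I) (P : pred I) (E : I -> H) K :
  dot (\sum_(i <- r | P i) E i) K = \sum_(i <- r | P i) dot (E i) K.
Proof.
by elim/big_rec2: _ => [|i x F _ <-]; rewrite ?dot0l ?dotDl.
Qed.

Lemma dot_sumr I (r : seq I) (P : pred I) (E : I -> H) K :
  dot K (\sum_(i <- r | P i) E i) = \sum_(i <- r | P i) dot K (E i).
Proof. by rewrite dotC dot_suml; under eq_bigr do rewrite dotC. Qed.

Lemma dot_inj F G : (forall K, dot F K = dot G K) -> F = G.
Proof.
move=> FG; apply/eqP; rewrite -subr_eq0; apply/eqP/dot_eq0.
by rewrite dotBl FG subrr.
Qed.

Lemma normL2_ge0 F : 0 <= normL2 F.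
Proof. exact: sqrtr_ge0. Qed.

Lemma normL2_sqr F : normL2 F ^+ 2 = dot F F.
Proof. by rewrite sqr_sqrtr// dot_ge0. Qed.

Lemma normL2_eq0 F : normL2 F = 0 -> F = 0.
Proof. by move=> F0; apply: dot_eq0; rewrite -normL2_sqr F0 expr0n. Qed.

Lemma normL20 : normL2 (0 : H) = 0.
Proof. by rewrite /normL2 dot0l sqrtr0. Qed.

Lemma normL2Z a F : normL2 (a *: F) = `|a| * normL2 F.
Proof.
by rewrite /normL2 dotZl dotZr mulrA -expr2 sqrtrM ?sqr_ge0// sqrtr_sqr.
Qed.

Lemma cauchy_schwarz F G : `|dot F G| <= normL2 F * normL2 G.
Proof.
rewrite -(ler_pXn2r (_ : 0 < 2)%N) ?nnegrE ?mulr_ge0 ?normL2_ge0//.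
rewrite real_normK ?num_real// exprMn !normL2_sqr.
have [G0|] := eqVneq (dot G G) 0; first by rewrite (dot_eq0 G0) !dot0r expr0n mulr0.
move=> G0; have {G0}Gp : 0 < dot G G by rewrite lt_def G0 dot_ge0.
(* This vector is [|G|^2] times the component of [F] orthogonal to [G]; its squared norm is
   [|G|^2 (|F|^2 |G|^2 - <F,G>^2)]. *)
have := dot_ge0 (dot G G *: F - dot F G *: G).
rewrite !(dotBl, dotBr, dotZl, dotZr) (dotC G F) => h.
rewrite -(ler_pM2l Gp) -subr_ge0; apply: le_trans h _.
by rewrite le_eqVlt; apply/orP; left; apply/eqP; ring.
Qed.

Lemma normL2D F G : normL2 (F + G) <= normL2 F + normL2 G.
Proof.
rewrite -(ler_pXn2r (_ : 0 < 2)%N) ?nnegrE ?addr_ge0 ?normL2_ge0//.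
rewrite sqrrD !normL2_sqr dotDl !dotDr (dotC G F).
have := le_trans (ler_norm _) (cauchy_schwarz F G).
move: (dot F F) (dot G G) => a b; move: (dot F G) (_ * _) => c e; lra.
Qed.

Lemma linear_map0 (U V : lmodType R) (B : U -> V) : linear B -> B 0 = 0.
Proof.
by move=> Bl; apply: (addrI (B 0)); rewrite -[X in X + _]scale1r -Bl scaler0 !addr0.
Qed.

Lemma cvgL2_lin a u v F G : cvgL2 u F -> cvgL2 v G ->
  cvgL2 (fun n => a *: u n + v n) (a *: F + G).
Proof.
move=> uF vG; rewrite /cvgL2.
apply: (@squeeze_cvgr _ _ _ _ (cst 0)
  (fun n => `|a| * normL2 (u n - F) + normL2 (v n - G))).
- near=> n; rewrite normL2_ge0/= -normL2Z.
  by rewrite opprD addrACA -scalerBr normL2D.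
- exact: cvg_cst.
- rewrite (_ : 0 = `|a| * 0 + 0); last by rewrite mulr0 addr0.
  by apply: cvgD => //; apply: cvgM => //; exact: cvg_cst.
Unshelve. all: by end_near. Qed.

Lemma cvgL2_cst F : cvgL2 (fun=> F) F.
Proof. by rewrite /cvgL2 subrr normL20; exact: cvg_cst. Qed.

Lemma cvgL2_scale (x : nat -> R) (a : R) F : x n @[n --> \oo] --> a ->
  cvgL2 (fun n => x n *: F) (a *: F).
Proof.
move=> xa; rewrite /cvgL2; under eq_fun do rewrite -scalerBl normL2Z.
rewrite -(mul0r (normL2 F)); apply: cvgM; last exact: cvg_cst.
by rewrite -(normr0 R); apply: cvg_norm; apply/subr_cvg0.
Qed.

Lemma cvgL2D u v F G : cvgL2 u F -> cvgL2 v G ->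
  cvgL2 (fun n => u n + v n) (F + G).
Proof.
move=> uF vG; rewrite -[F]scale1r; under eq_fun do rewrite -[u _]scale1r.
exact: cvgL2_lin.
Qed.

Lemma cvgL2_unique u F G : cvgL2 u F -> cvgL2 u G -> F = G.
Proof.
move=> uF uG; have := cvgL2_lin (-1) uF uG.
under eq_fun do rewrite scaleN1r addNr.
rewrite /cvgL2 => /(cvg_lim (@Rhausdorff R)); rewrite lim_cst//.
move=> /normL2_eq0/eqP; rewrite add0r oppr_eq0 scaleN1r addrC subr_eq0.
by move=> /eqP.
Qed.

Lemma cvg_dot u v F G : cvgL2 u F -> cvgL2 v G ->
  dot (u n) (v n) @[n --> \oo] --> dot F G.
Proof.
move=> uF vG; apply/subr_cvg0; apply/norm_cvg0P => /=.
(* The three terms bound, by Cauchy-Schwarz, the expansion of [<u n, v n> - <F, G>] around the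
   limits. *)
pose b n := normL2 (u n - F) * normL2 (v n - G)
  + normL2 F * normL2 (v n - G) + normL2 (u n - F) * normL2 G.
apply: (@squeeze_cvgr _ _ _ _ (cst 0) b).
- near=> n; rewrite normr_ge0/=.
  have -> : dot (u n) (v n) - dot F G = dot (u n - F) (v n - G)
      + dot F (v n - G) + dot (u n - F) G.
    by rewrite !(dotBl, dotBr); ring.
  apply: le_trans (ler_normD _ _) _; apply: lerD; last exact: cauchy_schwarz.
  by apply: le_trans (ler_normD _ _) _; apply: lerD; exact: cauchy_schwarz.
- exact: cvg_cst.
- rewrite (_ : 0 = 0 * 0 + normL2 F * 0 + 0 * normL2 G); last by ring.
  apply: cvgD; last by apply: cvgM => //; exact: cvg_cst.
  by apply: cvgD; apply: cvgM => //; exact: cvg_cst.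
Unshelve. all: by end_near. Qed.

Lemma cvg_normL2 u F : cvgL2 u F -> normL2 (u n) @[n --> \oo] --> normL2 F.
Proof.
move=> uF; apply: (cvg_comp _ _ (cvg_dot uF uF)).
exact: sqrt_continuous.
Qed.

Lemma bounded_cvgL2 (B : H -> H) c u F : linear B ->
  (forall K, normL2 (B K) <= c * normL2 K) -> cvgL2 u F -> cvgL2 (B \o u) (B F).
Proof.
move=> Bl Bb uF.
apply: (@squeeze_cvgr _ _ _ _ (cst 0) (fun n => c * normL2 (u n - F))).
- near=> n; rewrite normL2_ge0/=; apply: le_trans _ (Bb _).
  by rewrite addrC -scaleN1r -Bl scaleN1r addrC.
- exact: cvg_cst.
- by rewrite -(mulr0 c); apply: cvgM => //; exact: cvg_cst.
Unshelve. all: by end_near. Qed.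

End L2_geometry.

(** * Finite-dimensional subspaces and orthogonal projectors *)

Section finite_dimension.
Context d (T : measurableType d) (R : realType) (m : {measure set T -> \bar R}).
Local Notation H := (L2 m).
Implicit Types (f g h : H) (e o : nat -> H) (W : set H).

(** Families and coefficients are sequences on [nat], truncated at [n], so that families of
    different lengths share one type in inductions. *)
Definition span n e : set H :=
  [set f | exists c : nat -> R, f = \sum_(i < n) c i *: e i].

Definition orthonormal n e :=
  forall i j, (i < n)%N -> (j < n)%N -> dot (e i) (e j) = (i == j)%:R.

Definition subspace W :=
  W 0 /\ forall a f g, W f -> W g -> W (a *: f + g).

Lemma subspaceZ W a f : subspace W -> W f -> W (a *: f).
Proof. by move=> [W0 Wl] Wf; rewrite -[_ *: _]addr0; exact: Wl. Qed.

Lemma subspaceB W f g : subspace W -> W f -> W g -> W (f - g).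
Proof. by move=> [_ Wl] Wf Wg; rewrite addrC -scaleN1r; exact: Wl. Qed.

Lemma subspace_sum W n (c : nat -> R) e : subspace W ->
  (forall i, (i < n)%N -> W (e i)) -> W (\sum_(i < n) c i *: e i).
Proof.
move=> [W0 Wl] We; apply: (big_ind W) => [//|f g Wf Wg|i _].
  by rewrite -[f]scale1r; exact: Wl.
by apply: subspaceZ => //; exact: We.
Qed.

Lemma subspace_span n e : subspace (span n e).
Proof.
split=> [|a f g [cf ->] [cg ->]].
  by exists (fun=> 0); rewrite big1// => i _; rewrite scale0r.
exists (fun i => a * cf i + cg i); rewrite scaler_sumr -big_split/=.
by apply: eq_bigr => i _; rewrite scalerDl scalerA.
Qed.

Lemma span_mem n e i : (i < n)%N -> span n e (e i).
Proof.
move=> ni; exists (fun j => (j == i)%:R).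
rewrite (bigD1 (Ordinal ni))//= eqxx scale1r big1 ?addr0// => j ji.
by rewrite (_ : (_ == _) = false) ?scale0r//; apply: negbTE; exact: ji.
Qed.

Lemma sub_span W n e : subspace W -> (forall i, (i < n)%N -> W (e i)) ->
  span n e `<=` W.
Proof. by move=> sW We _ [c ->]; exact: subspace_sum sW We. Qed.

Lemma dot_orthonormal n o (c : nat -> R) i : orthonormal n o -> (i < n)%N ->
  dot (\sum_(j < n) c j *: o j) (o i) = c i.
Proof.
move=> oo ni; rewrite dot_suml (bigD1 (Ordinal ni))//= dotZl oo// eqxx mulr1.
rewrite big1 ?addr0// => j ji; rewrite dotZl oo// (_ : (_ == _) = false) ?mulr0//.
by apply: negbTE; exact: ji.
Qed.

Lemma gram_schmidt n e : exists k o, orthonormal k o /\ span n e = span k o.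
Proof.
elim: n => [|n [k [ o [oo spo]]]].
  by exists 0%N, e; split.
(* The residual of [e n] after projection on the vectors built so far. If it vanishes nothing is
   added, so [k] may stay below [n]; otherwise it is normalised and appended. *)
pose r := e n - \sum_(i < k) dot (e n) (o i) *: o i.
have re : e n = r + \sum_(i < k) dot (e n) (o i) *: o i by rewrite subrK.
have sE l (e' : nat -> H) : subspace (span l e') by exact: subspace_span.
have so : span k o `<=` span n.+1 e.
  by rewrite -spo; apply: sub_span => // i /ltnW ni; exact: span_mem.
have [r0|r0] := eqVneq r 0.
  exists k, o; split=> //; apply/seteqP; split=> //; apply: sub_span => // i.
  rewrite ltnS leq_eqVlt => /predU1P[->|ni]; last by rewrite -spo; exact: span_mem.
  rewrite re r0 add0r.
  apply: (subspace_sum (W := span k o) (fun i => dot (e n) (o i))) => // j.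
  exact: span_mem.
have nr : normL2 r != 0 by apply: contra_neq r0; exact: normL2_eq0.
pose o' i := if i == k then (normL2 r)^-1 *: r else o i.
have o'o i : (i < k)%N -> o' i = o i by rewrite /o' => /ltn_eqF ->.
have o'k : o' k = (normL2 r)^-1 *: r by rewrite /o' eqxx.
have ro i : (i < k)%N -> dot r (o i) = 0.
  by move=> ik; rewrite dotBl (dot_orthonormal (fun i => dot (e n) (o i)))// subrr.
exists k.+1, o'; split.
  move=> i j; rewrite (ltnS i) (ltnS j) (leq_eqVlt i) (leq_eqVlt j).
  move=> /predU1P[->|ik] /predU1P[->|jk].
  - by rewrite eqxx o'k dotZl dotZr -normL2_sqr mulr1n; field.
  - by rewrite o'k o'o// dotZl ro// mulr0 gtn_eqF.
  - by rewrite o'k o'o// dotZr dotC ro// mulr0 ltn_eqF.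
  - by rewrite !o'o// oo.
have so' : span k o `<=` span k.+1 o'.
  by apply: sub_span => // i ik; rewrite -o'o//; apply: span_mem; exact: ltnW.
have op : span k o (\sum_(i < k) dot (e n) (o i) *: o i).
  by exists (fun i => dot (e n) (o i)).
apply/seteqP; split; apply: sub_span => // i; rewrite ltnS leq_eqVlt => /predU1P[->|ni].
- have -> : e n = normL2 r *: o' k + \sum_(i < k) dot (e n) (o i) *: o i.
    by rewrite o'k scalerA divff// scale1r.
  by apply: (sE _ _).2; [exact: span_mem|exact: so'].
- by apply: so'; rewrite -spo; exact: span_mem.
- rewrite o'k; apply: subspaceZ => //; apply: subspaceB => //; first exact: span_mem.
  exact: so.
- by rewrite o'o//; apply: so; exact: span_mem.
Qed.

Lemma finite_dim_orthonormal W : finite_dim_subspace W ->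
  exists k o, orthonormal k o /\ W = span k o.
Proof.
move=> [n [e ->]].
(* The family indexed by ['I_n] is extended by 0 to all of [nat]. *)
have [k [ o [oo spo]]] := gram_schmidt n (fun i => oapp e 0 (insub i)).
exists k, o; split=> //; rewrite -spo; apply/seteqP; split=> f [c ->].
  exists (fun i => oapp c 0 (insub i)); apply: eq_bigr => i _.
  by rewrite valK.
by exists (fun i => c i); apply: eq_bigr => i _; rewrite valK.
Qed.

Lemma finite_dim_subspaceW W : finite_dim_subspace W -> subspace W.
Proof. by move=> /finite_dim_orthonormal[k [ o [_ ->]]]; exact: subspace_span. Qed.

(** The difference of two candidates lies in [W] and is orthogonal to [W], hence to itself. This
    identifies the value picked by [xget]. *)
Lemma orth_proj_unique W f g : subspace W -> W g ->
  (forall h, W h -> dot (f - g) h = 0) -> orth_proj W f = g.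
Proof.
move=> sW Wg fg; apply: xget_unique => // g' [Wg' fg'].
apply/eqP; rewrite -subr_eq0; apply/eqP/dot_eq0.
have Wgg : W (g' - g) by exact: subspaceB.
have {1}-> : g' - g = (f - g) - (f - g') by rewrite opprB [RHS]addrC addrA subrK.
by rewrite dotBl fg ?fg' ?subrr.
Qed.

Lemma orth_projP W f : finite_dim_subspace W ->
  W (orth_proj W f) /\ forall h, W h -> dot (f - orth_proj W f) h = 0.
Proof.
move=> fW; have sW := finite_dim_subspaceW fW.
have [k [ o [oo WE]]] := finite_dim_orthonormal fW.
(* The Fourier sum in an orthonormal basis supplies the existence that [xget] requires. *)
pose p := \sum_(i < k) dot f (o i) *: o i.
have Wp : W p by rewrite WE; exists (fun i => dot f (o i)).
have fp h : W h -> dot (f - p) h = 0.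
  rewrite WE => -[c ->]; rewrite dot_sumr big1// => i _.
  rewrite dotZr dotBl (dot_orthonormal (fun i => dot f (o i)))//.
  by rewrite subrr mulr0.
by rewrite (orth_proj_unique sW Wp fp).
Qed.

Lemma orth_proj_id W f : finite_dim_subspace W -> W f -> orth_proj W f = f.
Proof.
move=> fW Wf; apply: orth_proj_unique => //; first exact: finite_dim_subspaceW.
by move=> h _; rewrite subrr dot0l.
Qed.

Lemma orth_proj_lin W : finite_dim_subspace W -> linear (@orth_proj _ _ _ m W).
Proof.
move=> fW a f g; have sW := finite_dim_subspaceW fW.
have [Wf fP] := orth_projP f fW; have [Wg gP] := orth_projP g fW.
apply: orth_proj_unique => //; first exact: sW.2.
move=> h Wh; rewrite opprD addrACA -scalerBr dotDl dotZl fP// gP//.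
by rewrite mulr0 addr0.
Qed.

End finite_dimension.

(** * Exponential of an operator of finite rank *)

Section exponential_series.
Context (R : realType).
Implicit Types (a : nat -> R).

(** Exponential generating function of [a]. When [a n] is a coordinate of [B^n f], it is that
    coordinate of [exp(tB) f]. *)
Definition exp_series a t : R := limn (pseries (fun n => a n / n`!%:R) t).

Lemma cvg_exp_series a (c K t : R) : (forall n, `|a n| <= c * K ^+ n) ->
  cvgn (pseries (fun n => a n / n`!%:R) t).
Proof.
move=> aK; apply: normed_cvg; rewrite /normed_series_of/=.
(* The signs of [c] and [K] are not prescribed; the bound itself makes the product nonnegative. *)
have cK n : 0 <= c * K ^+ n by exact: le_trans (aK n).
apply: (@series_le_cvg _ _ (fun n => c * exp_coeff (K * `|t|) n)) => [n|n|n|].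
- exact: normr_ge0.
- by rewrite /exp_coeff/= exprMn mulrA mulrA divr_ge0// mulr_ge0// exprn_ge0.
- rewrite /exp_coeff/= normrM normf_div normrX (ger0_norm (_ : 0 <= n`!%:R))//.
  rewrite exprMn mulrA mulrA mulrAC ler_pM2r ?invr_gt0 ?ltr0n ?fact_gt0//.
  exact: ler_wpM2r.
- apply: is_cvg_seriesZ; exact: is_cvg_series_exp_coeff.
Qed.

(** The factorials absorb the factor produced by differentiation, so the derivative only shifts the
    sequence; each shift multiplies the constant of the geometric bound by [K]. *)
Lemma is_derive_exp_series a (c K t : R) : (forall n, `|a n| <= c * K ^+ n) ->
  is_derive t 1 (exp_series a) (exp_series (fun n => a n.+1) t).
Proof.
move=> aK.
have dE (b : nat -> R) :
    pseries_diffs (fun n => b n / n`!%:R) = (fun n => b n.+1 / n`!%:R).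
  apply/funext => n; rewrite /pseries_diffs factS natrM invfM.
  by rewrite mulrCA (mulrA n.+1%:R) divff ?mul1r.
have aK1 n : `|a n.+1| <= c * K * K ^+ n by rewrite -mulrA -exprS.
have aK2 n : `|a n.+2| <= c * K * K * K ^+ n by rewrite -!mulrA -!exprS.
rewrite /exp_series -(dE a).
(* Termwise differentiation at [t] asks for convergence of the series and of its first two derived
   series at a point of larger modulus. *)
apply: (@pseries_snd_diffs _ _ (`|t| + 1)); rewrite ?dE.
- exact: cvg_exp_series aK.
- exact: cvg_exp_series aK1.
- exact: cvg_exp_series aK2.
- by rewrite [ltRHS]ger0_norm ?ltrDl ?addr_ge0.
Qed.

End exponential_series.

Section operator_exponential.
Context d (T : measurableType d) (R : realType) (m : {measure set T -> \bar R}).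
Local Notation H := (L2 m).
(** Bilinearity turns [Q (x s) (x s)] into a finite double sum of products [E i s * E j s] with
    constant weights, so the scalar product rule suffices. [Q] may be asymmetric, whence two cross
    terms. *)
Lemma is_derive_bilinear (k : nat) (o : nat -> H) (Q : H -> H -> R)
    (E E' : nat -> R -> R) (s : R) :
  (forall a f g h, Q (a *: f + g) h = a * Q f h + Q g h) ->
  (forall a f g h, Q h (a *: f + g) = a * Q h f + Q h g) ->
  (forall i, (i < k)%N -> is_derive s 1 (E i) (E' i s)) ->
  let x s := \sum_(i < k) E i s *: o i in
  let x' := \sum_(i < k) E' i s *: o i in
  is_derive s 1 (fun s => Q (x s) (x s)) (Q (x s) x' + Q x' (x s)).
Proof.
move=> Ql Qr dE x x'.
have Qsuml (y : nat -> R) g :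
    Q (\sum_(i < k) y i *: o i) g = \sum_(i < k) y i * Q (o i) g.
  have Q0 : Q 0 g = 0.
    by apply: (addrI (Q 0 g)); rewrite addr0 -{1}[Q 0 g]mul1r -Ql scaler0 addr0.
  by elim/big_rec2: _ => // i u v _ <-; rewrite Ql.
have Qsumr (y : nat -> R) g :
    Q g (\sum_(i < k) y i *: o i) = \sum_(i < k) y i * Q g (o i).
  have Q0 : Q g 0 = 0.
    by apply: (addrI (Q g 0)); rewrite addr0 -{1}[Q g 0]mul1r -Qr scaler0 addr0.
  by elim/big_rec2: _ => // i u v _ <-; rewrite Qr.
have QE : (fun s => Q (x s) (x s)) =
    \sum_(i < k) \sum_(j < k) (fun s => E i s * E j s * Q (o i) (o j)).
  apply/funext => u; rewrite fct_sumE (Qsuml (E^~ u)); apply: eq_bigr => i _.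
  rewrite fct_sumE (Qsumr (E^~ u)) mulr_sumr.
  by apply: eq_bigr => j _; rewrite mulrA.
have -> : Q (x s) x' + Q x' (x s) = \sum_(i < k) \sum_(j < k)
    (E i s * E' j s + E' i s * E j s) * Q (o i) (o j).
  rewrite (Qsuml (E^~ s)) (Qsuml (E'^~ s)) -big_split/=; apply: eq_bigr => i _.
  rewrite (Qsumr (E^~ s)) (Qsumr (E'^~ s)) !mulr_sumr -big_split/=.
  by apply: eq_bigr => j _; rewrite mulrDl !mulrA.
rewrite QE; apply: is_derive_sum => i; apply: is_derive_sum => j.
have h := is_deriveM (is_deriveM (dE i (ltn_ord i)) (dE j (ltn_ord j)))
  (is_derive_cst (Q (o i) (o j)) s 1).
apply: is_derive_eq h _; rewrite scaler0 add0r /= /GRing.scale/=.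
by rewrite mulrC (mulrC (E j s)).
Qed.

Variables (k : nat) (o : nat -> H) (B : H -> H) (c : R).
Hypothesis o_orthonormal : orthonormal k o.
Hypothesis B_linear : linear B.
Hypothesis B_bounded : forall f, normL2 (B f) <= c * normL2 f.
Hypothesis B_span : forall f, span k o (B f).
Implicit Types f g : H.

Let coef f i n := dot (iter n B f) (o i).

Lemma cvgL2_coord (x : nat -> nat -> R) (y : nat -> R) :
  (forall i, (i < k)%N -> x i n @[n --> \oo] --> y i) ->
  cvgL2 (fun n => \sum_(i < k) x i n *: o i) (\sum_(i < k) y i *: o i).
Proof.
elim: k => [|l IH] xy.
  by under eq_fun do rewrite big_ord0; rewrite big_ord0; exact: cvgL2_cst.
rewrite big_ord_recr/=; under eq_fun do rewrite big_ord_recr/=.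
apply: cvgL2D; first by apply: IH => i il; apply: xy; exact: ltnW.
by apply: cvgL2_scale; exact: xy.
Qed.

Lemma span_coord f : span k o f -> f = \sum_(i < k) dot f (o i) *: o i.
Proof.
move=> [x fE]; rewrite {1}fE; apply: eq_bigr => i _.
by rewrite fE dot_orthonormal.
Qed.

Lemma coef_bound f i n : (i < k)%N -> `|coef f i n| <= normL2 f * c ^+ n.
Proof.
move=> ik; apply: le_trans (cauchy_schwarz _ _) _.
rewrite {2}/normL2 o_orthonormal// eqxx sqrtr1 mulr1.
have [c0|c0] := leP 0 c.
  elim: n => [|n IH] /=; first by rewrite expr0 mulr1.
  by rewrite exprS mulrCA; apply: le_trans (B_bounded _) _; exact: ler_wpM2l.
(* A negative [c] bounds a nonnegative norm only if every norm vanishes. *)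
have f0 g : normL2 g = 0.
  apply/eqP; rewrite eq_le normL2_ge0 andbT -(nmulr_rge0 _ c0).
  exact: le_trans (normL2_ge0 _) (B_bounded _).
by rewrite !f0 mul0r.
Qed.

Lemma iter_span n f : span k o f -> span k o (iter n B f).
Proof. by case: n => [|n] //= _; exact: B_span. Qed.

(** All iterates of [f] stay in the span, so the partial sums converge coordinate by coordinate,
    after exchanging the two finite sums. *)
Lemma cvg_exp_op t f : span k o f ->
  cvgL2 (fun n => \sum_(0 <= j < n) (t ^+ j / j`!%:R) *: iter j B f)
        (\sum_(i < k) exp_series (coef f i) t *: o i).
Proof.
move=> Wf.
pose x i n := series (fun j => coef f i j / j`!%:R * t ^+ j) n.
rewrite (_ : (fun n => _) = fun n => \sum_(i < k) x i n *: o i).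
  apply: (@cvgL2_coord x (fun i => exp_series (coef f i) t)) => i ik.
  exact: cvg_exp_series (fun n => coef_bound f n ik).
apply/funext => n; under eq_bigr do rewrite (span_coord (iter_span _ Wf)) scaler_sumr.
rewrite exchange_big/=; apply: eq_bigr => i _.
rewrite /x /series/= scaler_suml. apply: eq_bigr => j _.
by rewrite scalerA mulrC mulrA mulrAC.
Qed.

Lemma exp_opE t f : span k o f ->
  exp_op B t f = \sum_(i < k) exp_series (coef f i) t *: o i.
Proof.
move=> Wf; have cf := cvg_exp_op t Wf; apply: xget_unique => // g.
by move=> gP; exact: cvgL2_unique gP cf.
Qed.

Lemma exp_op0 f : span k o f -> exp_op B 0 f = f.
Proof.
move=> Wf; have := cvg_exp_op 0 Wf; rewrite -exp_opE// => h.
apply: (cvgL2_unique h); apply: cvg_near_cst; near=> n.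
have n0 : (0 < n)%N by near: n; exact: nbhs_infty_gt.
(* At [t = 0] only the term [j = 0] survives; it is present once [n >= 1]. *)
rewrite big_ltn// expr0 fact0 divr1 scale1r big_nat big1 ?addr0 ?subrr ?normL20//.
by move=> j /andP[j0 _]; rewrite expr0n gtn_eqF// mul0r scale0r.
Unshelve. all: by end_near. Qed.

(** Identifies the derivative of the exponential. Shifting the coefficients of [f] gives those of
    [B f], and the bounded operator [B] commutes with the limit of the partial sums. *)
Lemma exp_op_shift t f : span k o f ->
  \sum_(i < k) exp_series (fun n => coef f i n.+1) t *: o i = B (exp_op B t f).
Proof.
move=> Wf.
have -> : \sum_(i < k) exp_series (fun n => coef f i n.+1) t *: o i =
    \sum_(i < k) exp_series (coef (B f) i) t *: o i.
  apply: eq_bigr => i _.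
  rewrite (_ : (fun n => _) = coef (B f) i)//; apply/funext => n.
  by rewrite /coef iterSr.
apply: cvgL2_unique (cvg_exp_op t (B_span f)) _.
have BE n : \sum_(0 <= j < n) (t ^+ j / j`!%:R) *: iter j B (B f) =
    B (\sum_(0 <= j < n) (t ^+ j / j`!%:R) *: iter j B f).
  elim/big_rec2: _ => [|j g h _ ->]; first by rewrite (linear_map0 B_linear).
  by rewrite -iterSr B_linear.
rewrite [X in cvgL2 X _](funext BE) (exp_opE t Wf).
exact: bounded_cvgL2 B_linear B_bounded (cvg_exp_op t Wf).
Qed.

Lemma exp_op_decay (Q : H -> H -> R) rho f :
  (forall a f g h, Q (a *: f + g) h = a * Q f h + Q g h) ->
  (forall a f g h, Q h (a *: f + g) = a * Q h f + Q h g) ->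
  (forall g, span k o g -> Q (B g) g + Q g (B g) <= - rho * Q g g) ->
  span k o f ->
  forall t, 0 <= t ->
  Q (exp_op B t f) (exp_op B t f) <= expR (- rho * t) * Q f f.
Proof.
move=> Ql Qr QB Wf t t0.
have G'le s : Q (exp_op B s f) (B (exp_op B s f)) +
    Q (B (exp_op B s f)) (exp_op B s f) <= - rho * Q (exp_op B s f) (exp_op B s f).
  rewrite addrC; apply: QB; rewrite exp_opE//.
  by exists (fun i => exp_series (coef f i) s).
have dG (s : R) : is_derive s 1 (fun s => Q (exp_op B s f) (exp_op B s f))
    (Q (exp_op B s f) (B (exp_op B s f)) + Q (B (exp_op B s f)) (exp_op B s f)).
  rewrite -exp_op_shift//; under eq_fun do rewrite exp_opE//; rewrite exp_opE//.
  apply: (@is_derive_bilinear k o Q (fun i => exp_series (coef f i))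
    (fun i => exp_series (fun n => coef f i n.+1))) => // i ik.
  exact: is_derive_exp_series s (fun n => coef_bound f n ik).
move: G'le dG; set x := fun s => exp_op B s f.
rewrite -[exp_op B t f]/(x t) => G'le dG.
(* Grönwall's argument: with this integrating factor the differential inequality says that [F] is
   nonincreasing. *)
pose F (s : R) := expR (rho * s) * Q (x s) (x s).
have dF (s : R) : is_derive s 1 F
    (expR (rho * s) * (Q (x s) (B (x s)) + Q (B (x s)) (x s) + rho * Q (x s) (x s))).
  have d1 : is_derive s 1 (expR \o (rho \*: id)) (expR (rho * s) * rho).
    apply: is_derive_eq (is_derive1_comp (is_derive_expR (rho * s))
      (is_deriveZ rho (is_derive_id s 1))) _.
    by rewrite /GRing.scale/= mulr1 mulrC.
  apply: is_derive_eq (is_deriveM d1 (dG s)) _.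
  by rewrite /GRing.scale/=; ring.
have := @ler0_derive1_nincry _ F 0 _ _ _ 0 t (lexx _) t0.
have -> : F 0 = Q f f by rewrite /F mulr0 expR0 mul1r /x exp_op0.
rewrite /F => h.
rewrite -[leLHS]mul1r -expR0 -(addNr (rho * t)) expRD -mulrA mulNr.
rewrite ler_pM2l ?expR_gt0//; apply: h => [s _|s _|].
- by have [] := dF s.
- rewrite derive1E (@derive_val _ _ _ _ _ _ _ (dF s)).
  rewrite pmulr_rle0 ?expR_gt0// -lerBrDr sub0r -mulNr; exact: G'le.
- apply: continuous_subspaceT => s; apply: differentiable_continuous.
  by apply/derivable1_diffP; have [] := dF s.
Qed.

End operator_exponential.

(** * Boundedness, operator norm and adjoints *)

Section finite_dimensional_operator.
Context d (T : measurableType d) (R : realType) (m : {measure set T -> \bar R}).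
Local Notation H := (L2 m).
Implicit Types (f g h : H) (W : set H) (B : H -> H).

Lemma orth_proj_idem W f : finite_dim_subspace W ->
  orth_proj W (orth_proj W f) = orth_proj W f.
Proof. by move=> fW; apply: orth_proj_id => //; have [] := orth_projP f fW. Qed.

Lemma normL2_sum n (x : nat -> H) :
  normL2 (\sum_(i < n) x i) <= \sum_(i < n) normL2 (x i).
Proof.
elim/big_rec2: _ => [|i y z _ yz]; first by rewrite normL20.
by apply: le_trans (normL2D _ _) _; rewrite lerD2l.
Qed.

Lemma finite_dim_bounded W B : finite_dim_subspace W -> linear B ->
  (forall f, B (orth_proj W f) = B f) ->
  exists c, forall f, normL2 (B f) <= c * normL2 f.
Proof.
move=> fW Bl BW; have [k [ o [oo WE]]] := finite_dim_orthonormal fW.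
(* Expand the projection of [f] in the basis and use [|<f, o i>| <= |f|]. *)
exists (\sum_(i < k) normL2 (B (o i))) => f.
have PE : orth_proj W f = \sum_(i < k) dot f (o i) *: o i.
  have [Wp fp] := orth_projP f fW.
  rewrite [LHS](span_coord oo); last by rewrite -WE.
  apply: eq_bigr => i _; congr (_ *: _); apply/eqP; rewrite eq_sym -subr_eq0 -dotBl.
  by rewrite fp// WE; exact: span_mem.
rewrite -BW PE.
have -> : B (\sum_(i < k) dot f (o i) *: o i) = \sum_(i < k) dot f (o i) *: B (o i).
  by elim/big_rec2: _ => [|i y z _ <-]; rewrite ?Bl// (linear_map0 Bl).
apply: le_trans (normL2_sum _ (fun i => dot f (o i) *: B (o i))) _.
rewrite mulr_suml; apply: ler_sum => i _.
rewrite normL2Z mulrC; apply: ler_wpM2l; first exact: normL2_ge0.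
apply: le_trans (cauchy_schwarz _ _) _.
by rewrite /(normL2 (o i)) oo// eqxx sqrtr1 mulr1.
Qed.

Lemma op_norm_ge0 B : (0 <= op_norm B)%E.
Proof.
apply: (@le_trans _ _ (normL2 (B 0))%:E); first by rewrite lee_fin normL2_ge0.
by apply: ereal_sup_ubound; exists 0; rewrite //= normL20.
Qed.

Lemma op_norm_bound B (c : R) f : (forall a g, B (a *: g) = a *: B g) ->
  op_norm B = c%:E -> normL2 (B f) <= c * normL2 f.
Proof.
move=> BZ Bc; have [f0|f0] := eqVneq (normL2 f) 0.
  by rewrite (normL2_eq0 f0) -(scale0r 0) BZ !scale0r normL20 mulr0.
have fp : 0 < normL2 f by rewrite lt_def f0 normL2_ge0.
rewrite -ler_pdivrMr// mulrC -[X in X * _]ger0_norm ?invr_ge0 ?normL2_ge0//.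
rewrite -normL2Z -BZ -lee_fin -Bc; apply: ereal_sup_ubound.
exists ((normL2 f)^-1 *: f) => //=.
by rewrite normL2Z ger0_norm ?invr_ge0 ?normL2_ge0// mulVf.
Qed.

(** Pairing with an arbitrary vector moves [B] off the combination, and vectors with equal pairings
    coincide. *)
Lemma is_adjoint_linear B Bs : is_adjoint B Bs -> linear B.
Proof.
move=> BBs a f g; apply: dot_inj => h.
by rewrite BBs !dotDl !dotZl !BBs.
Qed.

Lemma is_adjointC B Bs : is_adjoint B Bs -> is_adjoint Bs B.
Proof. by move=> BBs f g; rewrite dotC -BBs dotC. Qed.

End finite_dimensional_operator.

(** * Decay of the Galerkin semigroup *)

Section galerkin.
Context (R : realType) (S : langevin R).
Local Notation H := (L2 (mu S)).
Variables (A As L : H -> H) (W : set H) (eps lam delta : R).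
Hypothesis AAs : is_adjoint A As.
Hypothesis A_half : forall f, normL2 (A f) <= 2^-1 * normL2 f.
Hypothesis W_fin : finite_dim_subspace W.
Hypothesis L_linear : forall a f g, W f -> W g -> L (a *: f + g) = a *: L f + L g.
Hypothesis eps_itv : 0 <= eps < 1.
Hypothesis L_coercive : forall f, W f ->
  lam * normL2 f ^+ 2 <=
  - dot (L f) f + eps * dot (A (L f)) f + eps * dot (A f) (L f).

Let B := galerkin_op L W.
Let WS := finite_dim_subspaceW W_fin.

Let W_proj f : W (orth_proj W f).
Proof. by have [] := orth_projP f W_fin. Qed.

Let A_linear : linear A. Proof. exact: is_adjoint_linear AAs. Qed.

(** [L] is linear on [W] only; the inner projection brings every argument there. *)
Lemma galerkin_linear : linear B.
Proof. by move=> a f g; rewrite /B /galerkin_op !(orth_proj_lin W_fin, L_linear). Qed.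

(** Homogeneity is what converts the supremum over the unit ball in [op_norm] into a bound for every
    vector. *)
Lemma consistency_op_scale a f :
  consistency_op A As L W (a *: f) = a *: consistency_op A As L W f.
Proof.
have As_linear : linear As by exact: is_adjoint_linear (is_adjointC AAs).
have linZ (K : H -> H) : linear K -> forall g, K (a *: g) = a *: K g.
  by move=> Kl g; exact: GRing.scalable_linear.
rewrite /consistency_op (linZ _ (orth_proj_lin W_fin)).
have -> : L (a *: orth_proj W f) = a *: L (orth_proj W f).
  have L0 : L 0 = 0.
    have W0 := WS.1.
    by apply: (addrI (L 0)); rewrite addr0 -{1}[L 0]scale1r -L_linear// scaler0 addr0.
  by rewrite -[X in L X]addr0 L_linear ?L0 ?addr0//; exact: WS.1.
rewrite (linZ _ (orth_proj_lin W_fin)) -scalerBr.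
by rewrite (linZ _ A_linear) (linZ _ As_linear) scalerDr.
Qed.

Let Q f g := 2^-1 * dot f g - eps * dot (A f) g.

Let Q_bounds f :
  (1 - eps) / 2 * normL2 f ^+ 2 <= Q f f <= (1 + eps) / 2 * normL2 f ^+ 2.
Proof.
have /andP[e0 e1] := eps_itv.
have : `|dot (A f) f| <= 2^-1 * normL2 f ^+ 2.
  apply: le_trans (cauchy_schwarz _ _) _; rewrite expr2 mulrA.
  by apply: ler_wpM2r; [exact: normL2_ge0|exact: A_half].
rewrite ler_norml /Q -normL2_sqr => /andP[h1 h2].
have k1 := ler_wpM2l e0 h1; have k2 := ler_wpM2l e0 h2.
move: k1 k2; move: (eps * dot _ _) (normL2 f ^+ 2) => x y k1 k2.
by apply/andP; split; lra.
Qed.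

Lemma galerkin_decay :
  (forall f, W f -> normL2 (consistency_op A As L W f) <= delta * normL2 f) ->
  0 <= lam - eps * delta ->
  forall f, W f -> forall t, 0 <= t ->
  normL2 (exp_op B t f) <= Num.sqrt ((1 + eps) / (1 - eps)) *
    expR (- ((lam - eps * delta) / (1 + eps)) * t) * normL2 f.
Proof.
move=> cons r0 f Wf t t0; have /andP[e0 e1] := eps_itv.
set r := (lam - eps * delta) / (1 + eps).
have re : r * (1 + eps) = lam - eps * delta by rewrite /r divfK//; lra.
have rge0 : 0 <= r by rewrite divr_ge0//; lra.
have [c Bc] : exists c, forall f, normL2 (B f) <= c * normL2 f.
  apply: (finite_dim_bounded W_fin galerkin_linear) => g.
  by rewrite /B /galerkin_op orth_proj_idem.
have [k [ o [oo WE]]] := finite_dim_orthonormal W_fin.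
have QB g : W g -> Q (B g) g + Q g (B g) <= - (2 * r) * Q g g.
  (* The part of [L g] removed by the projector is orthogonal to [g], so it affects [Q] only through
     the terms with [A]. *)
  move=> Wg; pose u := L g - orth_proj W (L g).
  have Bg : B g = L g - u by rewrite /B /galerkin_op (orth_proj_id W_fin Wg) /u subKr.
  have ug : dot u g = 0 by have [_] := orth_projP (L g) W_fin; exact.
  have cE : consistency_op A As L W g = A u + As u.
    by rewrite /consistency_op (orth_proj_id W_fin Wg).
  clearbody u.
  have Ag : A (B g) = A (L g) - A u.
    by rewrite Bg addrC -scaleN1r A_linear scaleN1r addrC.
  (* The adjoint turns [<As u, g>] into [<A g, u>], the error term coming from [<A g, B g>]. *)
  have -> : Q (B g) g + Q g (B g) = dot (L g) g - eps * dot (A (L g)) g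
      - eps * dot (A g) (L g) + eps * dot (consistency_op A As L W g) g.
    rewrite /Q Ag (dotC g) cE Bg.
    rewrite !(dotBl, dotBr) dotDl ug (dotC (As u)) -AAs; lra.
  have h1 := L_coercive Wg.
  have h2 : dot (consistency_op A As L W g) g <= delta * normL2 g ^+ 2.
    apply: le_trans (ler_norm _) _; apply: le_trans (cauchy_schwarz _ _) _.
    by rewrite expr2 mulrA; apply: ler_wpM2r; [exact: normL2_ge0|exact: cons].
  have h3 := ler_wpM2l e0 h2.
  have /andP[_ q2] := Q_bounds g.
  have h4 := ler_wpM2l rge0 q2.
  have h5 : r * ((1 + eps) / 2 * normL2 g ^+ 2) =
      (lam - eps * delta) * normL2 g ^+ 2 / 2.
    by rewrite -re; field.
  (* The left side is at most [-(lam - eps delta) |g|^2 = -r (1 + eps) |g|^2], and the upper bound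
     on [Q] makes this at most [-2 r Q g g]. *)
  move: h1 h3 h4 h5; nra.
have Qdec : Q (exp_op B t f) (exp_op B t f) <= expR (- (2 * r) * t) * Q f f.
  apply: (exp_op_decay oo galerkin_linear Bc) => //.
  - by move=> g; rewrite -WE; exact: W_proj.
  - by move=> a g h l; rewrite /Q A_linear !dotDl !dotZl; ring.
  - by move=> a g h l; rewrite /Q !dotDr !dotZr; ring.
  - by move=> g; rewrite -WE; exact: QB.
  - by rewrite -WE.
have ee : 0 < 1 - eps by lra.
rewrite -(ler_pXn2r (_ : 0 < 2)%N) ?nnegrE ?normL2_ge0//; last first.
  by rewrite !mulr_ge0 ?sqrtr_ge0 ?expR_ge0 ?normL2_ge0.
have ce : 0 <= (1 + eps) / (1 - eps) by rewrite divr_ge0//; lra.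
rewrite !exprMn (sqr_sqrtr ce).
have -> : expR (- r * t) ^+ 2 = expR (- (2 * r) * t).
  by rewrite -expRM_natl; congr expR; ring.
rewrite -(ler_pM2l ee).
set y := expR _; set z := normL2 f ^+ 2; set w := normL2 _ ^+ 2.
have -> : (1 - eps) * ((1 + eps) / (1 - eps) * y * z) = (1 + eps) * y * z.
  by field; rewrite gt_eqF.
(* The lower bound on [Q] is used at time [t] and the upper one at time 0; their ratio gives the
   prefactor. *)
have /andP[q1 _] := Q_bounds (exp_op B t f).
have /andP[_ q2] := Q_bounds f.
have q3 := ler_wpM2l (expR_ge0 (- (2 * r) * t)) q2.
move: q1 q3 Qdec; rewrite -/w -/z -/y; lra.
Qed.

End galerkin.

(** * Closures of the Langevin operators *)

Section smooth_functions.
Context (R : realType) (E : normedModType R).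
Implicit Types (f g : E -> R).

Lemma iter_derive_lin (s : seq E) a f g : smooth f -> smooth g ->
  iter_derive s (fun x => a * f x + g x) =
  (fun x => a * iter_derive s f x + iter_derive s g x).
Proof.
move=> sf sg; elim: s => [//|v s IH] /=; rewrite IH; apply/funext => x.
have [_ df] := sf s; have [_ dg] := sg s.
rewrite -[LHS]/('D_v (a \*: iter_derive s f + iter_derive s g) x).
by rewrite deriveD ?deriveZ//; exact: derivableZ.
Qed.

Lemma smooth_lin a f g : smooth f -> smooth g -> smooth (fun x => a * f x + g x).
Proof.
move=> sf sg s; rewrite iter_derive_lin//.
have [cf df] := sf s; have [cg dg] := sg s; split=> [x|x v].
  by apply: cvgD; [apply: cvgM; [exact: cvg_cst|exact: cf]|exact: cg].
rewrite -[X in derivable X]/(a \*: iter_derive s f + iter_derive s g).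
by apply: derivableD => //; exact: derivableZ.
Qed.

End smooth_functions.

Section langevin_graphs.
Context (R : realType) (S : langevin R).
Local Notation H := (L2 (mu S)).
Local Notation phase := ('rV[R]_(Defs.dim S) * 'rV[R]_(Defs.dim S))%type.
Implicit Types (phi psi : phase -> R) (G : set (H * H)).

Lemma test_phase_lin a phi psi : test_phase phi -> test_phase psi ->
  test_phase (fun x => a * phi x + psi x).
Proof.
move=> [sf pf [K Kf]] [sg pg [K' Kg]]; split; first exact: smooth_lin.
  case: (Defs.space S) pf pg => //= l pf pg q i; apply/funext => p.
  by rewrite (congr1 (@^~ p) (pf q i)) (congr1 (@^~ p) (pg q i)).
(* Beyond the larger of the two radii both functions vanish. *)
exists (Num.max K K') => q p; rewrite !gt_max => h.
have hK : (if Defs.space S is Torus _ then False else K < `|q|) \/ K < `|p|.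
  by case: (Defs.space S) h => [_|] [|/andP[? _]]; auto => /andP[]; auto.
have hK' : (if Defs.space S is Torus _ then False else K' < `|q|) \/ K' < `|p|.
  by case: (Defs.space S) h => [_|] [|/andP[_ ?]]; auto => /andP[]; auto.
by rewrite Kf// Kg// mulr0 addr0.
Qed.

Lemma dq_lin i a phi psi x : smooth phi -> smooth psi ->
  Defs.dq i (fun x => a * phi x + psi x) x = a * Defs.dq i phi x + Defs.dq i psi x.
Proof.
pose v : phase := (basis_rV i, 0).
by move=> sf sg; exact: (congr1 (@^~ x) (iter_derive_lin [:: v] a sf sg)).
Qed.

Lemma dp_lin i a phi psi x : smooth phi -> smooth psi ->
  dp i (fun x => a * phi x + psi x) x = a * dp i phi x + dp i psi x.
Proof.
pose v : phase := (0, basis_rV i).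
by move=> sf sg; exact: (congr1 (@^~ x) (iter_derive_lin [:: v] a sf sg)).
Qed.

Lemma dp_dp_lin i a phi psi x : smooth phi -> smooth psi ->
  dp i (dp i (fun x => a * phi x + psi x)) x =
  a * dp i (dp i phi) x + dp i (dp i psi) x.
Proof.
pose v : phase := (0, basis_rV i).
by move=> sf sg; exact: (congr1 (@^~ x) (iter_derive_lin [:: v; v] a sf sg)).
Qed.

Lemma ham_expr_lin a phi psi x : smooth phi -> smooth psi ->
  ham_expr (fun x => a * phi x + psi x) x = a * ham_expr phi x + ham_expr psi x.
Proof.
move=> sf sg; rewrite /ham_expr mulr_sumr -big_split/=; apply: eq_bigr => i _.
have E (b c u v y z : R) :
    b * (a * u + v) - c * (a * y + z) = a * (b * u - c * y) + (b * v - c * z) by ring.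
by rewrite (dq_lin i a x sf sg) (dp_lin i a x sf sg) E.
Qed.

Lemma FD_expr_lin a phi psi x : smooth phi -> smooth psi ->
  FD_expr (fun x => a * phi x + psi x) x = a * FD_expr phi x + FD_expr psi x.
Proof.
move=> sf sg; rewrite /FD_expr mulr_sumr -big_split/=; apply: eq_bigr => i _.
have E (b c u v y z : R) :
    b * (a * u + v) + c * (a * y + z) = a * (b * u + c * y) + (b * v + c * z) by ring.
by rewrite (dp_dp_lin i a x sf sg) (dp_lin i a x sf sg) E.
Qed.

Lemma langevin_expr_lin gamma a phi psi : smooth phi -> smooth psi ->
  langevin_expr gamma (fun x => a * phi x + psi x) =
  (fun x => a * langevin_expr gamma phi x + langevin_expr gamma psi x).
Proof.
move=> sf sg; apply/funext => x; rewrite /langevin_expr.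
have E (u v y z : R) :
    a * u + v + gamma * (a * y + z) = a * (u + gamma * y) + (v + gamma * z) by ring.
by rewrite (ham_expr_lin a x sf sg) (FD_expr_lin a x sf sg) E.
Qed.

Definition linear_graph G := forall a p q,
  G p -> G q -> G (a *: p.1 + q.1, a *: p.2 + q.2).

Lemma test_graph_langevin_lin gamma :
  linear_graph (test_graph (langevin_expr (S := S) gamma)).
Proof.
move=> a [f f'] [g g'] [phi [tf cf cf']] [psi [tg cg cg']].
exists (fun x => a * phi x + psi x); split.
- exact: test_phase_lin.
- exact: L2_class_lin.
- have [sf _ _] := tf; have [sg _ _] := tg.
  by rewrite langevin_expr_lin//; exact: L2_class_lin.
Qed.

Lemma closure_graph_lin G : linear_graph G -> linear_graph (closure_graph G).
Proof.
move=> Gl a p q [u [Gu u1 u2]] [v [Gv v1 v2]].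
exists (fun n => (a *: (u n).1 + (v n).1, a *: (u n).2 + (v n).2)); split.
- by move=> n; exact: Gl.
- exact: (cvgL2_lin a u1 v1).
- exact: (cvgL2_lin a u2 v2).
Qed.

Lemma graph_app (B : operator H) f : domain B f -> graph B (f, B f).
Proof. by []. Qed.

Lemma operator_lin (B : operator H) a f g : linear_graph (graph B) ->
  domain B f -> domain B g -> B (a *: f + g) = a *: B f + B g.
Proof. by move=> Bl Df Dg; have [] := Bl a _ _ (graph_app Df) (graph_app Dg). Qed.

(* Pairing [w + T^* T w = T^* u] with [w] gives
   [|w|^2 + |T w|^2 = <T w, u> <= |T w| |u|], hence [|w|^2 <= |u|^2 / 4]. *)
Lemma A_graph_bound (Lham : operator H) u w : A_graph Lham (u, w) ->
  normL2 w <= 2^-1 * normL2 u.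
Proof.
move=> [v [g [/= Tu Tw Tg]]].
have /= h1 := Tu _ Tw; have /= h2 := Tg _ Tw.
have h3 := le_trans (ler_norm _) (cauchy_schwarz g u).
rewrite dotBr -!normL2_sqr -h1 in h2.
rewrite -(ler_pXn2r (_ : 0 < 2)%N) ?nnegrE ?mulr_ge0 ?normL2_ge0//.
have := sqr_ge0 (normL2 g - normL2 u / 2); move: h2 h3.
move: (dot g u) (normL2 g) (normL2 u) (normL2 w) => x a c b; nra.
Qed.

(** Points of the graph of [A] are limits of pairs in [A_graph], and both norms converge along such
    limits. *)
Lemma A_bound (Lham : operator H) (A : H -> H) :
  [set uw | uw.2 = A uw.1] = closure_graph (A_graph Lham) ->
  forall f, normL2 (A f) <= 2^-1 * normL2 f.
Proof.
move=> AE f.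
have : [set uw | uw.2 = A uw.1] (f, A f) by [].
rewrite AE => -[u [Gu u1 u2]].
have u1' : 2^-1 * normL2 (u n).1 @[n --> \oo] --> 2^-1 * normL2 f.
  by apply: cvgM; [exact: cvg_cst|exact: cvg_normL2 u1].
apply: (ler_cvg_to (cvg_normL2 u2) u1').
by apply: nearW => n /=; apply: (@A_graph_bound Lham); rewrite -surjective_pairing.
Qed.

End langevin_graphs.

(** * The mean as a continuous linear form on [L2] *)

Section mean.
Context d (T : measurableType d) (R : realType) (m : {measure set T -> \bar R}).

Lemma L2_one : (m setT < +oo)%E -> exists one : L2 m, L2_class one (cst 1).
Proof.
move=> m_fin.
have one_Lfun : (cst 1 : T -> R) \in Lfun m 2%:E.
  rewrite inE; apply/andP; split; rewrite inE/=; first exact: measurable_cst.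
  rewrite /finite_norm (_ : EFin \o cst 1 = cst 1%E)// Lnorm_cst1.
  by apply: poweR_lty.
exists (pi_L2 (Lfun_Sub (lee1n 2) one_Lfun)).
by have := L2fun_pi (Lfun_Sub (lee1n 2) one_Lfun).
Qed.

Lemma mean_class (F : L2 m) (f : T -> R) : measurable_fun setT f ->
  L2_class F f -> mean F = \int[m]_x f x.
Proof.
move=> mf Ff; rewrite /mean /Rintegral; congr fine; apply: ae_eq_integral => //.
- by apply/measurable_EFinP; exact: measurable_L2fun.
- exact/measurable_EFinP.
- by apply: filterS Ff => x Ff _ /=; rewrite Ff.
Qed.

(** As a pairing with the constant 1, the mean passes to limits in [cvgL2]. *)
Lemma mean_dot (one F : L2 m) : L2_class one (cst 1) -> mean F = dot F one.
Proof.
move=> one1; rewrite /mean /dot /Rintegral; congr fine; apply: ae_eq_integral => //.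
- by apply/measurable_EFinP; exact: measurable_L2fun.
- by apply/measurable_EFinP; apply: measurable_funM; exact: measurable_L2fun.
- by apply: filterS one1 => x one1 _ /=; rewrite one1// mulr1.
Qed.

End mean.

(** * Measurability of continuous functions on phase space *)

Section phase_space.
Context (R : realType) (n : nat).

Let unpair (x : 'rV[R]_(n + n)) : 'rV[R]_n * 'rV[R]_n := (lsubmx x, rsubmx x).

Let continuous_lsubmx : continuous (@lsubmx R 1 n n).
Proof.
move=> x U /nbhs_ballP[e /= e0 eU]; apply/nbhs_ballP; exists e => //= y [_ xy].
by apply: eU; split=> // i j; rewrite !mxE; apply: xy; rewrite /= mem_index_enum.
Qed.

Let continuous_rsubmx : continuous (@rsubmx R 1 n n).
Proof.
move=> x U /nbhs_ballP[e /= e0 eU]; apply/nbhs_ballP; exists e => //= y [_ xy].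
by apply: eU; split=> // i j; rewrite !mxE; apply: xy; rewrite /= mem_index_enum.
Qed.

Let continuous_unpair : continuous unpair.
Proof.
move=> x U [[P Q] /= [nP nQ] PQU].
have := @filterI _ _ (nbhs_filter x) _ _ (continuous_lsubmx nP) (continuous_rsubmx nQ).
by apply: (@filterS _ _ (nbhs_filter x)) => y [yP yQ]; exact: PQU.
Qed.

(* Measurability of continuous functions is available on row vectors, so the
   phase space is identified with ['rV_(n + n)]. *)
Lemma continuous_measurable_phase (phi : 'rV[R]_n * 'rV[R]_n -> R) :
  continuous phi -> measurable_fun setT phi.
Proof.
move=> cphi.
have -> : phi = (phi \o unpair) \o (fun x => row_mx x.1 x.2).
  by apply/funext => -[q p] /=; rewrite /unpair row_mxKl row_mxKr.
apply: measurableT_comp.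
  apply: continuous_measurable_rV => x.
  by apply: continuous_comp; [exact: continuous_unpair|exact: cphi].
apply: measurable_fun_rVP => i; rewrite /comp /rV_coord.
case: (splitP i) => j ij.
  rewrite (_ : (fun x => _) = (@rV_coord R n j) \o fst).
    exact: measurableT_comp (measurable_rV_coord j) measurable_fst.
  apply/funext => -[q p] /=; rewrite (_ : i = lshift n j) ?row_mxEl//.
  exact: val_inj.
rewrite (_ : (fun x => _) = (@rV_coord R n j) \o snd).
  exact: measurableT_comp (measurable_rV_coord j) measurable_snd.
apply/funext => -[q p] /=; rewrite (_ : i = rshift n j) ?row_mxEr//.
exact: val_inj.
Qed.

End phase_space.

(** * Extension of coercivity from test functions to the closure *)

Section coercivity.
Context (R : realType) (S : langevin R).
Local Notation H := (L2 (mu S)).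
Local Notation phase := ('rV[R]_(Defs.dim S) * 'rV[R]_(Defs.dim S))%type.
Implicit Types (phi : phase -> R).

(* If the normalising integral were infinite, its real part would be 0, hence the
   density [0^-1 * _ = 0]: integrability need not be established. *)
Lemma mu_finite : (mu S setT < +oo)%E.
Proof.
rewrite -[mu S setT]/(weighted_measure _ _ _ _ _) /weighted_measure setTI /mu_density.
under eq_integral do rewrite EFinM.
have mD := @measurable_phase_cell R S.
have mf : measurable_fun (q_cell S `*` setT)
    (fun x => (expR (- beta S * hamiltonian (S := S) x))%:E).
  apply: measurable_funTS; apply/measurable_EFinP; apply: measurableT_comp => //.
  apply: measurable_funM => //; apply: measurable_funD.
    exact: measurableT_comp (@measurable_potential R S) measurable_fst.
  apply: measurable_funM => //.
  exact: measurableT_comp (@measurable_sqnorm R S) measurable_snd.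
have f0 x : (q_cell S `*` setT) x ->
    (0 <= (expR (- beta S * hamiltonian (S := S) x))%:E)%E.
  by rewrite lee_fin expR_ge0.
rewrite ge0_integralZl//; last first.
  by rewrite lee_fin invr_ge0; apply: Rintegral_ge0 => x _; exact: expR_ge0.
rewrite /Rintegral; set I := integral _ _ _.
have I0 : (0 <= I)%E by apply: integral_ge0 => x _; rewrite lee_fin expR_ge0.
case: I I0 => [r _| |//]; first by rewrite /= -EFinM ltry.
by rewrite /= invr0 mul0e.
Qed.

(** The constant cancels in the difference quotient itself, before any limit is taken. *)
Lemma derive_subc (v : phase) phi (c : R) :
  'D_v (fun x => phi x - c) = 'D_v phi.
Proof.
apply/funext => x; rewrite /derive.
by under eq_fun do rewrite opprB addrA subrK.
Qed.

Lemma langevin_expr_subc gamma phi (c : R) :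
  langevin_expr gamma (fun x => phi x - c) = langevin_expr gamma phi.
Proof.
have dqc i : Defs.dq i (fun x => phi x - c) = Defs.dq i phi by exact: derive_subc.
have dpc i : dp i (fun x => phi x - c) = dp i phi by exact: derive_subc.
have hamc x : ham_expr (fun x => phi x - c) x = ham_expr phi x.
  by apply: eq_bigr => i _; rewrite dqc dpc.
have FDc x : FD_expr (fun x => phi x - c) x = FD_expr phi x.
  by apply: eq_bigr => i _; rewrite dpc.
by apply/funext => x; rewrite /langevin_expr hamc FDc.
Qed.

(* The approximants in the graph of test functions need not have mean zero: their
   means, which tend to [mean f = 0], are subtracted. *)
Lemma coercive_closure (A : H -> H) gamma eps lam a f g : linear A ->
  (forall h, normL2 (A h) <= a * normL2 h) ->
  coercive A gamma eps lam ->
  closure_graph (test_graph (langevin_expr gamma)) (f, g) -> mean f = 0 ->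
  lam * normL2 f ^+ 2 <= - dot g f + eps * dot (A g) f + eps * dot (A f) g.
Proof.
move=> Al Ab Ac [u [Gu u1 u2]] f0.
have [one one1] := L2_one mu_finite.
pose F n := - mean (u n).1 *: one + (u n).1.
have Ff : cvgL2 F f.
  have mf : mean (u n).1 @[n --> \oo] --> 0.
    rewrite -f0 (mean_dot _ one1); under eq_fun do rewrite (mean_dot _ one1).
    exact: cvg_dot u1 (cvgL2_cst one).
  rewrite -[f]add0r -(scale0r one); apply: cvgL2D u1; apply: cvgL2_scale.
  by rewrite -oppr0; exact: cvgN.
have ineq n : lam * normL2 (F n) ^+ 2 <= - dot (u n).2 (F n)
    + eps * dot (A (u n).2) (F n) + eps * dot (A (F n)) (u n).2.
  have [phi [tphi c1 c2]] := Gu n; apply: (Ac phi tphi (F n) (u n).2).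
    have mphi : measurable_fun setT phi.
      by case: tphi => /(_ [::])[cphi _] _ _; exact: continuous_measurable_phase.
    (* The integral of [phi] is the mean of [(u n).1], so [F n] is the class of the centred test
       function. *)
    rewrite -(mean_class mphi c1).
    apply: filterS (L2_class_lin (- mean (u n).1) one1 c1) => x h _.
    by rewrite [LHS]h// mulr1 addrC.
  (* Centring does not change the image, which remains [(u n).2]. *)
  by rewrite langevin_expr_subc.
have AF := bounded_cvgL2 Al Ab Ff; have Ag := bounded_cvgL2 Al Ab u2.
have l1 : lam * normL2 (F n) ^+ 2 @[n --> \oo] --> lam * normL2 f ^+ 2.
  apply: cvgM; first exact: cvg_cst.
  rewrite normL2_sqr; under eq_fun do rewrite normL2_sqr.
  exact: (cvg_dot Ff Ff).
apply: (ler_cvg_to l1 _ (nearW _ ineq)) => /=.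
apply: cvgD; [apply: cvgD|].
- by apply: cvgN; exact: cvg_dot u2 Ff.
- by apply: cvgM; [exact: cvg_cst|exact: cvg_dot Ag Ff].
- by apply: cvgM; [exact: cvg_cst|exact: cvg_dot AF u2].
Qed.

End coercivity.

(** * Uniformity in the friction *)

Section decay.
Context (R : realType) (S : langevin R).
Local Notation H := (L2 (mu S)).
Variables (Lham LFD : operator H) (L : R -> operator H) (A As : H -> H).
Hypothesis ops : langevin_operators Lham LFD L A As.

(* [LFD] commutes with the projector, so that only [Lham] contributes to
   [(1 - Pi_M) L Pi_M]. *)
Lemma consistency_op_friction (W : set H) gamma gamma' :
  0 < gamma -> 0 < gamma' -> finite_dim_subspace W ->
  W `<=` domain Lham -> W `<=` domain LFD ->
  W `<=` domain (L gamma) -> W `<=` domain (L gamma') -> stabilizes LFD W ->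
  consistency_op A As (L gamma) W = consistency_op A As (L gamma') W.
Proof.
move=> g0 g0' fW Wham WFD WL WL' stab; apply/funext => f.
have [Wf _] := orth_projP f fW.
suff E c : 0 < c -> W `<=` domain (L c) ->
    L c (orth_proj W f) - orth_proj W (L c (orth_proj W f)) =
    Lham (orth_proj W f) - orth_proj W (Lham (orth_proj W f)).
  by rewrite /consistency_op (E gamma)// (E gamma').
move=> c0 Wc; move: (orth_proj W f) Wf => h Wh.
have [_ LFDh] := stab _ (WFD _ Wh); rewrite (orth_proj_id fW Wh) in LFDh.
rewrite (L_sum ops c0 (Wc _ Wh) (Wham _ Wh) (WFD _ Wh)) (addrC (Lham h)).
rewrite (orth_proj_lin fW) LFDh opprD addrACA.
by rewrite subrr add0r.
Qed.

Lemma friction_min_itv (gamma : R) : 0 < gamma -> 0 < friction_min gamma <= 1.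
Proof.
move=> g0; rewrite /friction_min lt_min g0 invr_gt0 g0/= ge_min.
have [//|g1] := leP gamma 1; apply/orP; right.
by rewrite invf_le1// ltW.
Qed.

(** Here [f] is the friction factor. Dropping the denominator of the loss [e f del / (1 + e f)] only
    enlarges it and leaves a bound proportional to [f]. *)
Lemma decay_rate_lower_bound (lambar e f del l : R) :
  0 <= e -> 0 <= f -> 0 <= del -> lambar * f <= l / (1 + e * f) ->
  (lambar - e * del) * f <= (l - e * f * del) / (1 + e * f).
Proof.
move=> e0 f0 d0 h; have ef := mulr_ge0 e0 f0.
rewrite mulrBl [leRHS]mulrBl lerB// ler_pdivrMr; last by lra.
by rewrite mulrAC ler_peMr ?mulr_ge0// lerDl.
Qed.

Lemma galerkin_decay_rate (W : set H) (eps epsbar lam delta gamma : R) :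
  finite_dim_subspace W -> W `<=` L20 (mu S) -> W `<=` domain (L gamma) ->
  0 < gamma -> coercive A gamma eps lam -> 0 <= eps <= epsbar -> epsbar < 1 ->
  op_norm (consistency_op A As (L gamma) W) = delta%:E ->
  0 < (lam - eps * delta) / (1 + eps) ->
  decay_rate (L gamma) W (Num.sqrt ((1 + epsbar) / (1 - epsbar)))
    ((lam - eps * delta) / (1 + eps)).
Proof.
move=> fW W0 WL g0 Acoer /andP[e0 ee] e1 nd r0.
have AAs := A_adjoint ops.
have Ahalf := A_bound (A_closure ops).
have Llin a f g : W f -> W g -> L gamma (a *: f + g) = a *: L gamma f + L gamma g.
  move=> Wf Wg; apply: operator_lin; [|exact: WL|exact: WL].
  rewrite (L_closure ops g0); apply: closure_graph_lin.
  exact: test_graph_langevin_lin.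
have eps_itv : 0 <= eps < 1 by rewrite e0 (le_lt_trans ee).
have coer f : W f -> lam * normL2 f ^+ 2 <= - dot (L gamma f) f
    + eps * dot (A (L gamma f)) f + eps * dot (A f) (L gamma f).
  move=> Wf; apply: (coercive_closure (is_adjoint_linear AAs) Ahalf Acoer).
    by rewrite -(L_closure ops g0); exact: graph_app (WL _ Wf).
  exact: W0.
have cons f : normL2 (consistency_op A As (L gamma) W f) <= delta * normL2 f.
  by apply: op_norm_bound nd => a g; exact: consistency_op_scale.
split=> // f Wf t t0.
have r1 : 0 <= lam - eps * delta.
  by move: r0; rewrite pmulr_lgt0 ?invr_gt0 => [/ltW//|]; lra.
apply: le_trans (galerkin_decay AAs Ahalf fW Llin eps_itv coer _ r1 Wf t0) _ => //.
(* Since [(1 + x) / (1 - x)] increases on [[0, 1)], the prefactor at [eps] is dominated by the one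
   at [epsbar], which is free of the friction. *)
rewrite -!mulrA ler_wpM2r ?mulr_ge0 ?expR_ge0 ?normL2_ge0//.
rewrite ler_sqrt; last by rewrite divr_ge0//; lra.
rewrite ler_pdivrMr; last by lra.
rewrite mulrAC ler_pdivlMr; last by lra.
nra.
Qed.

End decay.

Theorem theorem2 (R : realType) (S : langevin R)
    (hS : potential_assumption S)
    (Lham LFD : operator (L2 (mu S))) (L : R -> operator (L2 (mu S)))
    (A As : L2 (mu S) -> L2 (mu S))
    (hops : langevin_operators Lham LFD L A As)
    (epsbar lambar : R) (lamt : R -> R)
    (hcst : hypocoercivity_constants A epsbar lambar lamt) :
  exists2 C : R, 1 <= C &
  forall W : nat -> set (L2 (mu S)),
  (forall M, (1 <= M)%N ->
    [/\ finite_dim_subspace (W M), W M `<=` L20 (mu S),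
        W M `<=` domain Lham & W M `<=` domain LFD]) ->
  exists lam : R -> nat -> R,
    (forall gamma, 0 < gamma ->
      (forall M, (1 <= M)%N -> W M `<=` domain (L gamma)) ->
      op_norm (consistency_op A As (L gamma) (W M)) @[M --> \oo] --> 0%E ->
      (exists M0, forall M, (1 <= M)%N -> (M0 <= M)%N ->
        decay_rate (L gamma) (W M) C (lam gamma M)) /\
      lam gamma M @[M --> \oo] -->
        lamt gamma / (1 + epsbar * friction_min gamma)) /\
    ((forall gamma, 0 < gamma ->
        forall M, (1 <= M)%N -> W M `<=` domain (L gamma)) ->
     (forall M, (1 <= M)%N -> stabilizes LFD (W M)) ->
     (exists2 gamma, 0 < gamma &
        op_norm (consistency_op A As (L gamma) (W M)) @[M --> \oo] --> 0%E) ->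
     exists2 Mstar : nat, (1 <= Mstar)%N &
     exists2 lambarM : nat -> R, lambarM M @[M --> \oo] --> lambar &
     forall M, (Mstar <= M)%N -> forall gamma, 0 < gamma ->
       decay_rate (L gamma) (W M) C (lam gamma M) /\
       lambarM M * friction_min gamma <= lam gamma M).
Proof.
have /andP[eb0 eb1] := epsbar_itv hcst.
exists (Num.sqrt ((1 + epsbar) / (1 - epsbar))).
  rewrite -{1}(sqrtr1 R) ler_sqrt; last by rewrite divr_ge0//; lra.
  by rewrite ler_pdivlMr; lra.
move=> W hW.
pose eps gamma := epsbar * friction_min gamma.
(* [fine] sends an infinite norm to 0, so decay at rate [lam gamma M] is claimed only where the norm
   is finite. *)
pose delta gamma M := fine (op_norm (consistency_op A As (L gamma) (W M))).
pose lam gamma M := (lamt gamma - eps gamma * delta gamma M) / (1 + eps gamma).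
have eps_itv gamma : 0 < gamma -> 0 < eps gamma <= epsbar.
  move=> /friction_min_itv/andP[f0 f1].
  by rewrite mulr_gt0//= -[leRHS]mulr1 ler_pM2l.
have decay gamma M : 0 < gamma -> (1 <= M)%N -> W M `<=` domain (L gamma) ->
    op_norm (consistency_op A As (L gamma) (W M)) \is a fin_num ->
    0 < lam gamma M ->
    decay_rate (L gamma) (W M) (Num.sqrt ((1 + epsbar) / (1 - epsbar))) (lam gamma M).
  move=> g0 M1 WL fin lam0; have [fW W0 _ _] := hW M M1.
  have /andP[/ltW e0 e1] := eps_itv _ g0.
  apply: (galerkin_decay_rate hops) => //.
  - exact: lamt_coercive hcst _ g0.
  - by rewrite e0.
  - by rewrite fineK.
have delta_ge0 gamma M : 0 <= delta gamma M by exact: fine_ge0 (op_norm_ge0 _).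
(* Convergence of the extended norms splits into eventual finiteness and convergence of the reals
   [delta]. *)
exists lam; split=> [gamma g0 WL|WL stab [g1 g1_gt0]] /fine_cvgP[fin delta0].
  have /andP[e0 e1] := eps_itv _ g0.
  have lam_cvg : lam gamma M @[M --> \oo] --> lamt gamma / (1 + eps gamma).
    have -> : lamt gamma / (1 + eps gamma) =
        (lamt gamma - eps gamma * 0) / (1 + eps gamma) by rewrite mulr0 subr0.
    apply: cvgM; last exact: cvg_cst.
    apply: cvgB; first exact: cvg_cst.
    by apply: cvgM; [exact: cvg_cst|exact: delta0].
  split=> //.
  have rate_gt0 : 0 < lamt gamma / (1 + eps gamma).
    by rewrite divr_gt0 ?(lamt_gt0 hcst)// addr_gt0.
  (* Beyond [N] the norm is finite and the rate, having a positive limit, is positive. *)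
  have [N _ hN] := filterI fin (cvgr_gt _ lam_cvg _ rate_gt0).
  exists N => M M1 NM; have [finM lamM] := hN M NM.
  by apply: decay => //; exact: WL.
(* The defect is measured at the reference friction [g1], so this bound does not involve [gamma]. *)
pose lambarM M := lambar - epsbar * delta g1 M.
have lambar_cvg : lambarM M @[M --> \oo] --> lambar.
  have -> : lambar = lambar - epsbar * 0 by rewrite mulr0 subr0.
  apply: cvgB; first exact: cvg_cst.
  by apply: cvgM; [exact: cvg_cst|exact: delta0].
have [N _ hN] := filterI fin (cvgr_gt _ lambar_cvg _ (lambar_gt0 hcst)).
(* The assumptions on the Galerkin spaces start at index 1. *)
exists (maxn 1 N); first by rewrite leq_maxl.
exists lambarM => // M; rewrite geq_max => /andP[M1 NM] gamma g0.
have [finM lambarM0] := hN M NM; have [fW W0 Wham WFD] := hW M M1.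
(* Stabilization transfers finiteness and size of the defect from [g1] to every friction, with the
   same threshold. *)
have consE : consistency_op A As (L gamma) (W M) = consistency_op A As (L g1) (W M).
  by apply: (consistency_op_friction hops) => //; [exact: WL|exact: WL|exact: stab].
have deltaE : delta gamma M = delta g1 M by rewrite /delta consE.
have /andP[fm0 _] := friction_min_itv g0; have /andP[e0 _] := eps_itv _ g0.
have lam_ge : lambarM M * friction_min gamma <= lam gamma M.
  rewrite /lambarM /lam deltaE.
  apply: decay_rate_lower_bound (lamt_ge hcst g0).
  - exact: ltW.
  - exact: ltW.
  - exact: delta_ge0.
split; last exact: lam_ge.
apply: decay g0 M1 (WL _ g0 _ M1) _ _; first by rewrite consE.
by apply: lt_le_trans lam_ge; exact: mulr_gt0.
Qed.
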